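(* Let $F\subset \mathbb{R}$ be an $F_\sigma$ set. Then there exists a continuous function $f\colon \mathbb{R}\to \mathbb{R}$ such that $l_f^\infty=F$, that is, $\{x\in\mathbb{R}:\operatorname{lip} f(x)=\infty\}=F$.
   Context: An $F_\sigma$ set is a countable union of closed sets. For a continuous function $f\colon\mathbb{R}\to\mathbb{R}$ and $x\in\mathbb{R}$, $$\operatorname{lip} f(x)=\liminf_{r\to 0^+}\ \sup_{|x-y|\le r}\frac{|f(y)-f(x)|}{r}\in[0,\infty],$$ and $l_f^\infty=\{x\in \mathbb{R}: \operatorname{lip} f(x)=\infty\}$. *)

(* Defs.v *)
From mathcomp Require Import all_boot all_order all_algebra.
From mathcomp Require Import all_classical all_reals all_analysis.

Set Implicit Arguments.
Unset Strict Implicit.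
Unset Printing Implicit Defensive.

Import Order.TTheory GRing.Theory Num.Theory.
Import numFieldNormedType.Exports.

Local Open Scope classical_set_scope.
Local Open Scope ring_scope.

Definition lip {R : realType} (f : R -> R) (x : R) : \bar R :=
  limf_einf
    (fun r : R => ereal_sup
       [set (`|f y - f x| / r)%:E | y in [set y | `|x - y| <= r]])
    0^'+.

Definition l_infty {R : realType} (f : R -> R) : set R :=
  [set x | lip f x = +oo%E].

(* Main.v *)
Require Import Defs.
From mathcomp Require Import all_boot all_order all_algebra.
From mathcomp Require Import all_classical all_reals all_analysis.
From mathcomp Require Import borel_hierarchy.
From mathcomp Require Import ring lra.

(** Write [F°] for the interior of [F] and [S = F \ F°], an F_sigma set whose
  complement is dense.

  Two mechanisms produce points where lip f is infinite, and both can be confined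
  to a closed set outside of which f is locally constant.
  - [fat_piece]: let [B] be compact and meet in positive measure every
    neighbourhood of each of its points.  Then [G x = |B ∩ ]-oo, x]|] is constant
    off [B] and increases at every point of [B], and [w \o G] is steep exactly on
    [B] if [w] oscillates enough at every scale.
  - [null_piece]: let [E] be compact and null.  The sum of the masses of
    neighbourhoods of [E] with summable measures is monotone and has infinite
    derivative on [E].  It grows off [E] too, but it may be made constant on any open
    set [W] which is thin at the points of [E].

  The compact sets of both kinds, if disjoint, are glued by a series
  ([gluing]): each term is constant off a compact set [T i], these sets are disjoint,
  and the coefficient of the i-th term is small with respect to the distance from
  [T i] to the earlier sets.  At a point of [T i], the earlier terms
  are constant and the later ones contribute a bounded slope.  A point outside
  all the [T i] sees, at the scale of its distance to the first n sets, only
  the later terms, which are tiny there: so lip is finite.  For a fat set, [T i] is the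
  set itself; for a null set it is a neighbourhood from which neighbourhoods of the
  later null sets have been removed ([steep_disjoint_pieces]); its additional points
  are not in [S] and the function has bounded slopes there, which does no harm.

  It remains to cut [S] into such pieces ([steep_empty_interior]).  Let [V] be the
  largest open set in which [S] is null.  As [S] has positive measure in every
  neighbourhood of each point of [S \ V], closed subsets of [S \ V] are contained in
  fat closed subsets of [S \ V] ([fat_envelope]), and an increasing sequence of closed
  sets is cut into disjoint compact pieces at points outside of [S]
  ([disjoint_pieces]), which are available since the complement of [S] is dense.

  Finally the interior is dealt with by adding [p w], where [p] is the distance to
  the complement of [F°], and [w] is rough compared to the function already
  constructed ([steep_add_open]). *)

Import Order.TTheory GRing.Theory Num.Theory.
Import numFieldNormedType.Exports.

Local Open Scope classical_set_scope.
Local Open Scope ring_scope.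

Set Implicit Arguments.
Unset Strict Implicit.
Unset Printing Implicit Defensive.

(** * Steep and tame points *)

(** The property that [lip f x] is infinite, free of extended reals: see [lip_steepE]. *)
Definition steep {R : realType} (f : R -> R) (x : R) : Prop :=
  forall M, 0 < M -> exists2 d, 0 < d & forall r, 0 < r < d ->
    exists2 y, `|x - y| <= r & M * r <= `|f y - f x|.

Lemma lip_steepE {R : realType} (f : R -> R) (x : R) :
  lip f x = +oo%E <-> steep f x.
Proof.
rewrite /lip limf_einfE; split => [lipoo M M0|st].
- have : (M%:E < +oo :> \bar R)%E by rewrite ltry.
  rewrite -lipoo => /ereal_sup_gt [_ [V Vnb <-] MV].
  have {Vnb} : nbhs (0:R)^'+ V by [].
  rewrite /at_right/= => /nbhs_ballP[d /= d0 dV].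
  exists d => // r /andP[r0 rd].
  have Vr : V r.
    apply: dV; last exact: r0.
    by rewrite /ball/= sub0r normrN gtr0_norm.
  have : (M%:E < ereal_sup [set (`|f y - f x| / r)%:E | y in [set y | (`|x - y| <= r)%R]])%E.
    by apply: lt_le_trans MV _; apply: ereal_inf_lbound; exists r.
  move=> /ereal_sup_gt [_ [y /= xy <-]]; rewrite lte_fin ltr_pdivlMr// => My.
  by exists y => //; apply: ltW.
- apply/eqyP => M _.
  pose M1 := Num.max M 1.
  have M10 : 0 < M1 by rewrite lt_max ltr01 orbT.
  have [d d0 dP] := st _ M10.
  apply: (@le_trans _ _ M1%:E); first by rewrite lee_fin le_max lexx.
  apply: ereal_sup_ge.
  exists (ereal_inf ((fun r : R => ereal_sup
       [set (`|f y - f x| / r)%:E | y in [set y | `|x - y| <= r]]) @` [set r | 0 < r < d])).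
    exists [set r | 0 < r < d] => //.
    apply/nbhs_ballP; exists d => //= r; rewrite /ball/= sub0r normrN => rd r0.
    by rewrite r0 /=; apply: le_lt_trans rd; rewrite ler_norm.
  apply: le_ereal_inf_tmp => _ [r /= rd <-].
  have [y xy My] := dP _ rd.
  apply: ereal_sup_ge; exists (`|f y - f x| / r)%:E; first by exists y.
  by rewrite lee_fin ler_pdivlMr//; case/andP: rd.
Qed.

Definition tame {R : realType} (g : R -> R) (x : R) : Prop :=
  exists C, exists2 d, 0 < d & forall y, `|x - y| < d -> `|g y - g x| <= C * `|x - y|.

Lemma steepD {R : realType} (f g : R -> R) (x : R) :
  steep f x -> tame g x -> steep (f \+ g) x.
Proof.
move=> sf [C [e e0 gC]] M M0.
pose N := M + Num.max C 0.
have C0 : 0 <= Num.max C 0 by rewrite le_max lexx orbT.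
have N0 : 0 < N by rewrite ltr_wpDr.
have [d d0 dP] := sf _ N0.
exists (Num.min d e); first by rewrite lt_min d0.
move=> r /andP[r0]; rewrite lt_min => /andP[rd re].
have [|y xy fy] := dP r; first by rewrite r0.
exists y => //.
have := gC y (le_lt_trans xy re).
have CC : C * `|x - y| <= Num.max C 0 * r.
  by apply: (@le_trans _ _ (Num.max C 0 * `|x - y|));
    [rewrite ler_wpM2r// le_max lexx|rewrite ler_wpM2l].
move=> gy; rewrite /= opprD addrACA.
have := lerB_normD (f y - f x) (g y - g x).
move: fy; rewrite /N mulrDl; lra.
Qed.

Lemma tameN {R : realType} (g : R -> R) (x : R) : tame g x -> tame (\- g) x.
Proof.
move=> [C [d d0 gC]]; exists C, d => // y /gC.
by rewrite /= -opprD normrN.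
Qed.

(** lip is a lower limit, so that arbitrarily small good scales suffice. *)
Lemma not_steep {R : realType} (f : R -> R) (x C : R) :
  (forall e, 0 < e -> exists2 r, 0 < r < e &
     forall y, `|x - y| <= r -> `|f y - f x| <= C * r) -> ~ steep f x.
Proof.
move=> H st.
have C0 : 0 < Num.max C 0 + 1 by rewrite ltr_wpDl// le_max lexx orbT.
have [d d0 dP] := st _ C0.
have [r rd rP] := H _ d0.
have [y xy fy] := dP _ rd.
have := rP _ xy; case/andP: rd => r0 _.
have : C * r <= Num.max C 0 * r by rewrite ler_wpM2r ?le_max ?lexx// ltW.
by move: fy; rewrite mulrDl mul1r; lra.
Qed.

Lemma tame_not_steep {R : realType} (f : R -> R) (x : R) : tame f x -> ~ steep f x.
Proof.
move=> [C [d d0 fC]].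
have C0 : 0 <= Num.max C 0 by rewrite le_max lexx orbT.
apply: (@not_steep _ _ _ (Num.max C 0)) => e e0.
exists (Num.min d e / 2).
  rewrite divr_gt0 ?lt_min ?d0//=.
  by apply: (@lt_le_trans _ _ (Num.min d e)); rewrite ?ge_min ?lexx ?orbT// ltr_pdivrMr// ltr_pMr ?lt_min ?d0// ltr1n.
move=> y xy.
have yd : `|x - y| < d.
  apply: le_lt_trans xy _.
  by apply: (@lt_le_trans _ _ (Num.min d e)); rewrite ?ge_min ?lexx ?orbT// ltr_pdivrMr// ltr_pMr ?lt_min ?d0// ltr1n.
apply: le_trans (fC y yd) _.
by apply: (@le_trans _ _ (Num.max C 0 * `|x - y|));
    [rewrite ler_wpM2r// le_max lexx|rewrite ler_wpM2l].
Qed.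

Lemma steepDr {R : realType} (f g : R -> R) (x : R) : tame g x ->
  steep (f \+ g) x <-> steep f x.
Proof.
move=> tg; split => [sfg|sf]; last exact: steepD.
have -> : f = (f \+ g) \+ (\- g) by apply/funext => y /=; rewrite addrK.
by apply: steepD => //; apply: tameN.
Qed.

Lemma steepZ {R : realType} (c : R) (f : R -> R) (x : R) : c != 0 ->
  steep (fun y => c * f y) x <-> steep f x.
Proof.
suff H : forall c f, c != 0 -> steep f x -> steep (fun y => c * f y) x.
  move=> c0; split => [|/H]; last exact.
  move=> /(H c^-1); rewrite invr_eq0 => /(_ c0).
  by under eq_fun do rewrite mulKf//.
move=> {}c {}f c0 sf M M0.
have nc : 0 < `|c| by rewrite normr_gt0.
have [|d d0 dP] := sf (M / `|c|); first by rewrite divr_gt0.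
exists d => // r rd; have [y xy fy] := dP r rd.
exists y => //; rewrite -mulrBr normrM.
by move: fy; rewrite mulrAC ler_pdivrMr// mulrC (mulrC _ `|c|).
Qed.

(** Uniform continuity, in the form in which it passes to sums of series
  without choosing a modulus. *)
Definition nearly_Lipschitz {R : realType} (f : R -> R) : Prop :=
  forall e, 0 < e -> exists2 L, 0 <= L & forall x y, `|f x - f y| <= e + L * `|x - y|.

Lemma nearly_Lipschitz_modulus {R : realType} (f : R -> R) (e : R) :
  nearly_Lipschitz f -> 0 < e ->
  exists2 d, 0 < d & forall x y, `|x - y| <= d -> `|f x - f y| <= e.
Proof.
move=> nf e0; have e20 : 0 < e / 2 by rewrite divr_gt0.
have [L L0 LP] := nf _ e20.
have L1 : 0 < L + 1 by rewrite ltr_wpDl.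
exists (e / 2 / (L + 1)); first by rewrite divr_gt0.
move=> x y; rewrite ler_pdivlMr// => xy.
apply: le_trans (LP x y) _.
have := normr_ge0 (x - y); nra.
Qed.

Lemma nearly_Lipschitz_continuous {R : realType} (f : R -> R) :
  nearly_Lipschitz f -> continuous f.
Proof.
move=> nf x; apply/cvgrPdist_le => e e0.
have [d d0 dP] := nearly_Lipschitz_modulus nf e0.
apply/nbhs_ballP; exists d => //= y; rewrite /ball/= => /ltW xy.
exact: dP.
Qed.

(** * Truncated distance and geometric series of functions *)

(** Truncation at 1 gives a distance to the empty set as well. *)
Definition dst {R : realType} (A : set R) (x : R) : R :=
  inf (1 |` [set `|x - a| | a in A]).

Section truncated_distance.
Context {R : realType}.
Implicit Types (A : set R) (x y a : R).

Let has_lb A x : has_lbound (1 |` [set `|x - a| | a in A]).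
Proof. by exists 0 => _ [->|[a _ <-]]. Qed.

Lemma dst_ge0 A x : 0 <= dst A x.
Proof. by apply: lb_le_inf; [exists 1; left|move=> _ [->|[a _ <-]]]. Qed.

Lemma dst_le1 A x : dst A x <= 1.
Proof. by apply: ge_inf => //; left. Qed.

Lemma dst_le A x a : A a -> dst A x <= `|x - a|.
Proof. by move=> Aa; apply: ge_inf => //; right; exists a. Qed.

Lemma dst_eq0 A x : A x -> dst A x = 0.
Proof.
move=> Ax; apply/eqP; rewrite eq_le dst_ge0 andbT.
by have := dst_le x Ax; rewrite subrr normr0.
Qed.

Lemma dst_lt A x e : dst A x < e -> e <= 1 -> exists2 a, A a & `|x - a| < e.
Proof.
move=> dA e1; have e0 : 0 < e - dst A x by rewrite subr_gt0.
have [|z] := inf_adherent e0 (_ : has_inf (1 |` [set `|x - a| | a in A])).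
  by split => //; exists 1; left.
rewrite -/(dst A x) addrC subrK => -[->|[a Aa <-]] ze; last by exists a.
by have := lt_le_trans ze e1; rewrite ltxx.
Qed.

Lemma dst_lipschitz A x y : `|dst A x - dst A y| <= `|x - y|.
Proof.
suff H z t : dst A z - dst A t <= `|z - t|.
  by rewrite ler_norml H andbT lerNl opprB distrC H.
rewrite lerBlDr -lerBlDl; apply: lb_le_inf; first by exists 1; left.
move=> _ [->|[a Aa <-]].
  by have := dst_le1 A z; have := normr_ge0 (z - t); lra.
have := dst_le z Aa; have := ler_distD t z a; lra.
Qed.

Lemma dst_gt0 A x : closed A -> ~ A x -> 0 < dst A x.
Proof.
move=> cA Ax; rewrite lt_neqAle dst_ge0 andbT eq_sym; apply/eqP => d0.
apply: Ax; apply: cA => B /nbhs_ballP[e /= e0 eB].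
have [||a Aa xa] := @dst_lt A x (Num.min e 1).
- by rewrite d0 lt_min e0 ltr01.
- by rewrite ge_min lexx orbT.
- by exists a; split => //; apply: eB; rewrite /ball/=; move: xa; rewrite lt_min => /andP[].
Qed.

Lemma dst_continuous A : continuous (dst A).
Proof.
move=> x; apply/cvgrPdist_le => e e0; apply/nbhs_ballP; exists e => //= y.
by rewrite /ball/= => /ltW; apply: le_trans; exact: dst_lipschitz.
Qed.

Lemma open_dst_lt A (e : R) : open [set x | dst A x < e].
Proof.
rewrite (_ : mkset _ = dst A @^-1` [set t | t < e])//.
by move/continuousP: (@dst_continuous A); apply; exact: open_lt.
Qed.

Lemma closed_dst_le A (e : R) : closed [set x | dst A x <= e].
Proof.
rewrite (_ : mkset _ = dst A @^-1` [set t | t <= e])//.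
by move/continuous_closedP: (@dst_continuous A); apply; exact: closed_le.
Qed.

Lemma compact_closedR A : compact A -> closed A.
Proof. exact: compact_closed (@Rhausdorff R). Qed.

Lemma compact_closed_dst (C Q : set R) : compact C -> closed Q -> C `&` Q = set0 ->
  exists2 a, 0 < a & forall x, C x -> a <= dst Q x.
Proof.
move=> cC cQ CQ; have [->|/set0P C0] := eqVneq C set0; first by exists 1.
have [|c /[!inE] Cc cP] := compact_EVT_min C0 cC (_ : {within C, continuous (dst Q)}).
  by apply: continuous_subspaceT => x; exact: dst_continuous.
exists (dst Q c); last by move=> x Cx; apply: cP; rewrite inE.
by apply: dst_gt0 => // Qc; have : (C `&` Q) c by []; rewrite CQ.
Qed.

Lemma compact_within (C : set R) : compact C ->
  exists2 N : R, 0 < N & forall x, C x -> `|x| < N.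
Proof.
move=> /compact_bounded [N [_ NP]]; exists (Num.max N 0 + 2).
  by rewrite ltr_wpDl// le_max lexx orbT.
move=> x Cx; have := NP (Num.max N 0 + 1) _ x Cx; rewrite /= => H.
apply: le_lt_trans (H _) _; last by rewrite ltrD2l ltr1n.
by rewrite ltr_pwDr// le_max lexx.
Qed.

Lemma closed_within_compact (C : set R) (N : R) : closed C ->
  (forall x, C x -> `|x| <= N) -> compact C.
Proof.
move=> cC CN; apply: (@subclosed_compact _ _ `[- N, N]) => //.
  exact: segment_compact.
by move=> x /CN; rewrite ler_norml /= in_itv.
Qed.

End truncated_distance.

Section geometric_bounds.
Context {R : realType}.
Implicit Types (u : nat -> R) (c : R).

Lemma half_expr_lt (e : R) : 0 < e -> exists k, 1 / 2 ^+ k < e.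
Proof.
move=> e0; have := @cvg_geometric R 1 (2^-1).
rewrite gtr0_norm ?invr_gt0// invf_lt1// ltr1n => /(_ isT).
move=> /cvgrPdist_lt /(_ e e0)[k _ /(_ k (leqnn _))].
rewrite /geometric/= sub0r normrN mul1r exprVn gtr0_norm ?invr_gt0 ?exprn_gt0// => H.
by exists k; rewrite mul1r.
Qed.

Lemma cvg_series_geometric u c : (forall i, `|u i| <= c / 2 ^+ i) -> cvgn (series u).
Proof.
move=> uc; apply: normed_cvg.
apply: (@series_le_cvg _ _ (geometric c 2^-1)) => //.
- by move=> i /=.
- by move=> i; rewrite /geometric/= exprVn; exact: le_trans (uc i).
- by move=> i; rewrite /geometric/= exprVn.
- by apply: is_cvg_geometric_series; rewrite gtr0_norm ?invr_gt0// invf_lt1// ltr1n.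
Qed.

Lemma lim_series_tail u c (n : nat) : cvgn (series u) ->
  (forall i, (n <= i)%N -> `|u i| <= c / 2 ^+ i) ->
  `|limn (series u) - \sum_(i < n) u i| <= 2 * c / 2 ^+ n.
Proof.
move=> cu uc.
have c0 : 0 <= c.
  have := le_trans (normr_ge0 _) (uc n (leqnn n)).
  by rewrite pmulr_lge0// invr_gt0 exprn_gt0.
have H m : `|series u (n + m)%N - \sum_(i < n) u i| <= 2 * c / 2 ^+ n - 2 * c / 2 ^+ (n + m).
  elim: m => [|m IH]; first by rewrite addn0 /series/= big_mkord !subrr normr0.
  rewrite addnS -addn1 -(subrK (series u (n + m)) (series u _)) addn1 seriesSB -addrA.
  apply: le_trans (ler_normD _ _) _.
  apply: le_trans (lerD (uc _ (leq_addr _ _)) IH) _.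
  by rewrite exprS invfM le_eqVlt; apply/orP; left; apply/eqP; field; rewrite !expf_neq0.
have cv : series u m @[m --> \oo] --> limn (series u) by [].
have cv2 : `|series u m - \sum_(i < n) u i| @[m --> \oo] --> `|limn (series u) - \sum_(i < n) u i|.
  by apply: cvg_norm; apply: cvgB => //; exact: cvg_cst.
apply: (cvgr_to_le cv2); near=> m.
have nm : (n <= m)%N by near: m; exists n.
rewrite -(subnKC nm); apply: le_trans (H _) _.
by rewrite lerBlDr lerDl divr_ge0 ?mulr_ge0// exprn_ge0.
Unshelve. all: by end_near. Qed.

Lemma lim_series_ge u (n : nat) : cvgn (series u) -> (forall i, (n <= i)%N -> 0 <= u i) ->
  \sum_(i < n) u i <= limn (series u).
Proof.
move=> cu u0; have cv : series u m @[m --> \oo] --> limn (series u) by [].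
apply: (cvgr_to_ge cv); near=> m.
have nm : (n <= m)%N by near: m; exists n.
rewrite /series/= -(big_mkord xpredT) (big_cat_nat (leq0n n) nm)//= lerDl.
by rewrite big_nat_cond sumr_ge0// => i /andP[/andP[ni _] _]; exact: u0.
Unshelve. all: by end_near. Qed.

(** The only limits of functions below are sums of series of functions bounded
  by a multiple of [1 / 2 ^ i]; the increments of such a sum are again sums of
  series, of the increments of the terms. *)
Definition sum_fun (h : nat -> R -> R) (x : R) : R := limn (series (h^~ x)).

Lemma sum_funB h c x y : (forall i z, `|h i z| <= c / 2 ^+ i) ->
  cvgn (series (fun i => h i y - h i x)) /\
  sum_fun h y - sum_fun h x = limn (series (fun i => h i y - h i x)).
Proof.
move=> hc; have ch z : cvgn (series (h^~ z)) by apply: (@cvg_series_geometric _ c).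
have -> : series (fun i => h i y - h i x) = series (h^~ y) - series (h^~ x).
  by rewrite -seriesN -seriesD.
by split; [exact: is_cvgB|rewrite /sum_fun limB].
Qed.

Lemma sum_fun_tail h c b (n : nat) x y : (forall i z, `|h i z| <= c / 2 ^+ i) ->
  (forall i, (n <= i)%N -> `|h i y - h i x| <= b / 2 ^+ i) ->
  `|sum_fun h y - sum_fun h x - \sum_(i < n) (h i y - h i x)| <= 2 * b / 2 ^+ n.
Proof.
by move=> hc hb; have [cv ->] := sum_funB x y hc; exact: lim_series_tail.
Qed.

Lemma sum_fun_bound h c x : (forall i z, `|h i z| <= c / 2 ^+ i) -> `|sum_fun h x| <= 2 * c.
Proof.
move=> hc; have := @lim_series_tail (h^~ x) c 0%N.
rewrite big_ord0 subr0 expr0 divr1; apply => //.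
exact: (@cvg_series_geometric _ c).
Qed.

Lemma sum_fun_nearly_Lipschitz h c : (forall i z, `|h i z| <= c / 2 ^+ i) ->
  (forall i, nearly_Lipschitz (h i)) -> nearly_Lipschitz (sum_fun h).
Proof.
move=> hc hL e e0; have e20 : 0 < e / 2 by rewrite divr_gt0.
have c0 : 0 <= c by have := hc 0%N 0; rewrite expr0 divr1; exact: le_trans.
have [n nP] : exists n, 2 * (2 * c) / 2 ^+ n < e / 2.
  have [|n nP] := @half_expr_lt (e / 2 / (4 * c + 1)).
    by rewrite divr_gt0// ltr_wpDl// mulr_ge0.
  exists n; move: nP; rewrite ltr_pdivlMr ?ltr_wpDl ?mulr_ge0//; apply: le_lt_trans.
  have : 0 <= (2 ^+ n)^-1 :> R by rewrite invr_ge0 exprn_ge0.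
  by rewrite mul1r; nra.
have [L L0 LP] : exists2 L, 0 <= L & forall x y,
    `|\sum_(i < n) (h i x - h i y)| <= e / 2 + L * `|x - y|.
  elim: n {nP} (e / 2) e20 => [|n IH] a a0.
    by exists 0 => // x y; rewrite big_ord0 normr0 mul0r addr0 ltW.
  have a20 : 0 < a / 2 by rewrite divr_gt0.
  have [L L0 LP] := IH _ a20; have [K K0 KP] := hL n _ a20.
  exists (L + K) => [|x y]; first by rewrite addr_ge0.
  rewrite big_ord_recr/=; apply: le_trans (ler_normD _ _) _.
  by have := LP x y; have := KP x y; rewrite mulrDl; lra.
exists L => // x y.
have := @sum_fun_tail h c (2 * c) n y x hc.
have := LP x y.
have H i : (n <= i)%N -> `|h i x - h i y| <= 2 * c / 2 ^+ i.
  move=> _; apply: le_trans (ler_normB _ _) _.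
  by rewrite -mulrA mulr_natl mulr2n lerD.
move=> A /(_ H) B.
have := ler_normD (sum_fun h x - sum_fun h y - \sum_(i < n) (h i x - h i y)) (\sum_(i < n) (h i x - h i y)).
by rewrite subrK; lra.
Qed.

End geometric_bounds.

(** * Gluing functions which vary on disjoint compact sets *)

Definition const_off {R : realType} (h : R -> R) (T : set R) : Prop :=
  forall x y, x <= y -> (forall t, x <= t <= y -> ~ T t) -> h x = h y.

Lemma const_off_ball {R : realType} (h : R -> R) (T : set R) (x d : R) :
  const_off h T -> (forall t, T t -> d <= `|x - t|) ->
  forall y, `|x - y| < d -> h y = h x.
Proof.
move=> hT Td y; rewrite ltr_norml => /andP[yl yr].
have H t : Num.min x y <= t <= Num.max x y -> ~ T t.
  move=> /andP[]; rewrite ge_min le_max => lo hi /Td; apply/negP.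
  rewrite -ltNge ltr_norml; apply/andP.
  by case/orP: lo => ?; case/orP: hi => ?; split; lra.
have [xy|yx] := leP x y.
  by apply/esym/hT => // t txy; apply: H; rewrite min_l ?max_r.
by apply: hT => [|t txy]; [exact: ltW|apply: H; rewrite min_r ?max_l// ltW].
Qed.

Lemma compact_separated {R : realType} (T : nat -> set R) (i : nat) :
  (forall i, compact (T i)) -> (forall i j, i != j -> T i `&` T j = set0) ->
  exists2 a, 0 < a <= 1 & forall j, (j < i)%N -> forall x y, T j x -> T i y -> a <= `|x - y|.
Proof.
move=> cT dT.
have [||a a0 aP] := @compact_closed_dst R (T i) (\bigcup_(j in `I_i) T j) (cT i).
- apply: closed_bigcup => [|j _]; first exact: finite_II.
  exact: compact_closedR.
- rewrite -subset0 => x [Tx [j /= ji Tjx]].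
  have : (T i `&` T j) x by [].
  by rewrite dT// gtn_eqF.
exists (Num.min a 1); first by rewrite lt_min a0 ltr01/= ge_min lexx orbT.
move=> j ji x y Tx Ty; rewrite ge_min; apply/orP; left.
by apply: le_trans (aP _ Ty) _; rewrite distrC; apply: dst_le; exists j.
Qed.

(** The radius [a i] separates [T i] from the earlier sets, and the coefficient of
  [h i] in the glued function is [a i / 4 / 2 ^+ i]. *)
Section gluing.
Context {R : realType} (T : nat -> set R) (h : nat -> R -> R) (a : nat -> R).
Hypothesis cT : forall i, compact (T i).
Hypothesis nh : forall i, nearly_Lipschitz (h i).
Hypothesis h1 : forall i x, `|h i x| <= 1.
Hypothesis hT : forall i, const_off (h i) (T i).
Hypothesis a01 : forall i, 0 < a i <= 1.
Hypothesis aP : forall i j, (j < i)%N -> forall x y, T j x -> T i y -> a i <= `|x - y|.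

Let a0 i : 0 < a i. Proof. by case/andP: (a01 i). Qed.

Let H i x := a i / 4 / 2 ^+ i * h i x.

Let coef_gt0 i : 0 < a i / 4 / 2 ^+ i.
Proof. by rewrite divr_gt0 ?exprn_gt0// divr_gt0. Qed.

Let H_bound i x : `|H i x| <= 4^-1 / 2 ^+ i.
Proof.
rewrite normrM gtr0_norm//; apply: (@le_trans _ _ (a i / 4 / 2 ^+ i)).
  by rewrite ler_piMr// ltW.
rewrite ler_pM2r ?invr_gt0 ?exprn_gt0// ler_piMl// ?invr_ge0//.
by case/andP: (a01 i).
Qed.

Let H_nearly_Lipschitz i : nearly_Lipschitz (H i).
Proof.
move=> e e0; have [L L0 LP] := nh i (divr_gt0 e0 (coef_gt0 i)).
exists (a i / 4 / 2 ^+ i * L) => [|x y]; first by rewrite mulr_ge0// ltW.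
rewrite -mulrBr normrM gtr0_norm//.
apply: le_trans (ler_wpM2l (ltW (coef_gt0 i)) (LP x y)) _.
by rewrite mulrDr [_ * (e / _)]mulrC divfK ?gt_eqF// mulrA.
Qed.

Let H_ball i x d : (forall t, T i t -> d <= `|x - t|) ->
  forall y, `|x - y| < d -> H i y = H i x.
Proof. by move=> Td y xy; rewrite /H (const_off_ball (@hT i) Td). Qed.

(* Seen from an earlier set, a term of the series is as good as Lipschitz, with a
   summable constant: it is constant up to the distance [a i], and beyond it its total
   oscillation is small compared to that distance. *)
Let H_increment i j x y : (j < i)%N -> T j x -> `|H i y - H i x| <= `|x - y| / 2 / 2 ^+ i.
Proof.
move=> ji Tx; have [xy|xy] := ltP `|x - y| (a i).
  rewrite (@H_ball i x (a i)) ?subrr ?normr0 ?divr_ge0 ?exprn_ge0//.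
  by move=> t Tt; exact: aP Tx Tt.
rewrite -mulrBr normrM gtr0_norm//.
apply: (@le_trans _ _ (a i / 4 / 2 ^+ i * 2)).
  rewrite ler_pM2l//; apply: le_trans (ler_normB _ _) _.
  by rewrite -[leRHS]/(1 + 1) lerD.
rewrite mulrAC ler_pM2r ?invr_gt0 ?exprn_gt0//; move: xy; lra.
Qed.

Let before x n : (forall i, ~ T i x) -> 0 < dst (\bigcup_(j in `I_n) T j) x.
Proof.
move=> Tx; apply: dst_gt0; last by case=> j _ /Tx.
apply: closed_bigcup => [|j _]; first exact: finite_II.
exact: compact_closedR.
Qed.

Let dst_before x n i t : (i < n)%N -> T i t -> dst (\bigcup_(j in `I_n) T j) x <= `|x - t|.
Proof. by move=> lin Tt; apply: dst_le; exists i. Qed.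

Let gluing_on i x : (forall j, j != i -> ~ T j x) -> T i x ->
  steep (sum_fun H) x <-> steep (h i) x.
Proof.
move=> Tjx Tx; rewrite -(@steepZ _ (a i / 4 / 2 ^+ i) (h i)) ?gt_eqF//.
have -> : sum_fun H = (fun y => a i / 4 / 2 ^+ i * h i y) \+ (sum_fun H \- H i).
  by apply/funext => y /=; rewrite /H addrC subrK.
apply: steepDr; exists 1.
exists (dst (\bigcup_(j in `I_i) T j) x).
  apply: dst_gt0.
    apply: closed_bigcup => [|j _]; first exact: finite_II.
    exact: compact_closedR.
  by case=> j /= ji; apply: Tjx; rewrite ltn_eqF.
move=> y xy.
have := @sum_fun_tail _ H _ (`|x - y| / 2) i.+1 x y H_bound (fun l il => H_increment y il Tx).
rewrite big_ord_recr/= big1 => [|l _]; last first.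
  by rewrite (@H_ball l x (dst (\bigcup_(j in `I_i) T j) x)) ?subrr// => t; exact: dst_before.
rewrite add0r [2 * _]mulrC divfK// => B.
rewrite mul1r; have -> : (sum_fun H \- H i) y - (sum_fun H \- H i) x =
    sum_fun H y - sum_fun H x - (H i y - H i x) by rewrite /=; ring.
apply: le_trans B _.
by rewrite ler_pdivrMr ?exprn_gt0// ler_peMr// exprn_ege1// ler1n.
Qed.

(* If the distances from [x] to the first n sets do not tend to 0, the sum is
   constant near [x].  Otherwise let [d] be such a distance: on the ball of radius [d / 2]
   the first n terms are constant, and the later ones are controlled from a point of
   these sets at distance at most [2 * d]. *)
Let gluing_off x : (forall i, ~ T i x) -> ~ steep (sum_fun H) x.
Proof.
move=> Tx; have [[r r0 rP]|far] := pselect (exists2 r, 0 < r & forall n, r <= dst (\bigcup_(j in `I_n) T j) x).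
  apply: tame_not_steep; exists 0, r => // y xy.
  have := @sum_fun_tail _ H _ 0 0 x y H_bound.
  rewrite big_ord0 mulr0 mul0r subr0 mul0r; apply => i _.
  rewrite (@H_ball i x r) ?subrr ?normr0 ?mul0r// => t Tt.
  by apply: le_trans (rP i.+1) _; exact: dst_before Tt.
apply: (@not_steep _ _ _ 9) => e e0.
have [n ne] : exists n, dst (\bigcup_(j in `I_n) T j) x < Num.min e 1.
  apply: contrapT => /forallNP ne; apply: far; exists (Num.min e 1).
    by rewrite lt_min e0 ltr01.
  by move=> n; rewrite leNgt; apply/negP.
have d0 := before n Tx.
move: ne; set d := dst _ _ in d0 *; rewrite lt_min => /andP[de d1].
exists (d / 2); first by rewrite divr_gt0//; lra.
move=> y xy.
have [||x' [j /= jn Tx'] xx'] := @dst_lt _ (\bigcup_(j in `I_n) T j) x (Num.min (2 * d) 1).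
- by rewrite -/d lt_min d1 andbT; lra.
- by rewrite ge_min lexx orbT.
have {}xx' : `|x - x'| < 2 * d by move: xx'; rewrite lt_min => /andP[].
have yx' : `|x' - y| <= `|x - x'| + `|x - y|.
  by have := ler_distD x x' y; rewrite [`|x' - x|]distrC.
have := @sum_fun_tail _ H _ (9 * d / 4) n x y H_bound.
rewrite big1 => [|l _]; last first.
  rewrite (@H_ball l x d) ?subrr// => [t Tt|]; first exact: dst_before Tt.
  by apply: le_lt_trans xy _; lra.
rewrite subr0 => B; apply: le_trans (B _) _.
  move=> i ni.
  have ji := leq_trans jn ni.
  have -> : H i y - H i x = (H i y - H i x') - (H i x - H i x') by lra.
  apply: le_trans (ler_normB _ _) _.
  apply: le_trans (lerD (H_increment y ji Tx') (H_increment x ji Tx')) _.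
  rewrite -mulrDl ler_pM2r ?invr_gt0 ?exprn_gt0// [`|x' - x|]distrC; lra.
rewrite ler_pdivrMr ?exprn_gt0//.
apply: (@le_trans _ _ (9 * (d / 2))); first lra.
by rewrite ler_peMr ?exprn_ege1 ?ler1n//; lra.
Qed.

Lemma gluing_separated : (forall i j, i != j -> T i `&` T j = set0) ->
  exists f, [/\ nearly_Lipschitz f,
    forall i x, T i x -> (steep f x <-> steep (h i) x) &
    forall x, (forall i, ~ T i x) -> ~ steep f x].
Proof.
move=> dT; exists (sum_fun H); split => // [|i x Tx].
  exact: sum_fun_nearly_Lipschitz H_bound _.
apply: gluing_on => // j ji Tjx.
by have : (T j `&` T i) x by []; rewrite dT.
Qed.

End gluing.

Lemma gluing {R : realType} (T : nat -> set R) (h : nat -> R -> R) :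
  (forall i, compact (T i)) -> (forall i j, i != j -> T i `&` T j = set0) ->
  (forall i, nearly_Lipschitz (h i)) -> (forall i x, `|h i x| <= 1) ->
  (forall i, const_off (h i) (T i)) ->
  exists f, [/\ nearly_Lipschitz f,
    forall i x, T i x -> (steep f x <-> steep (h i) x) &
    forall x, (forall i, ~ T i x) -> ~ steep f x].
Proof.
move=> cT dT nh h1 hT.
have /choice[a aP] : forall i, exists a, 0 < a <= 1 /\
    forall j, (j < i)%N -> forall x y, T j x -> T i y -> a <= `|x - y|.
  by move=> i; have [a] := compact_separated i cT dT; exists a.
by apply: (@gluing_separated _ T h a) => // i; case: (aP i).
Qed.

(** * A function which oscillates at every scale *)

Section rough_function.
Context {R : realType}.

Let Z : set R := [set m%:~R | m in [set: int]].

(* The distance to the integers takes the values 0 and 1/2 on every interval of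
   length 1, hence a value at distance 1/4 from any given number. *)
Let dstZ_spread (b c : R) : exists2 v, b <= v <= b + 1 & 4^-1 <= `|dst Z v - c|.
Proof.
have [lo hi] : (Num.floor (b + 1))%:~R <= b + 1 /\ b + 1 < (Num.floor (b + 1) + 1)%:~R.
  by split; [exact: ge_floor|rewrite floorD1_gt].
have [lo2 hi2] : (Num.floor (b + 2^-1))%:~R <= b + 2^-1 /\ b + 2^-1 < (Num.floor (b + 2^-1) + 1)%:~R.
  by split; [exact: ge_floor|rewrite floorD1_gt].
move: hi hi2; rewrite !intrD => hi hi2.
pose u : R := (Num.floor (b + 1))%:~R; pose v : R := (Num.floor (b + 2^-1))%:~R + 2^-1.
have du : dst Z u = 0 by apply: dst_eq0; exists (Num.floor (b + 1)).
have dv : 2^-1 <= dst Z v.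
  apply: lb_le_inf; first by exists 1; left.
  move=> _ [->|[_ [m _ <-] <-]]; first lra.
  rewrite /v; set n := Num.floor _; have [nm|mn] := leP m n.
    have : m%:~R <= n%:~R :> R by rewrite ler_int.
    by move=> nm'; rewrite ger0_norm; lra.
  have : (n + 1)%:~R <= m%:~R :> R by rewrite ler_int lezD1.
  rewrite intrD => mn'; rewrite ltr0_norm; lra.
have [c4|c4] := leP (4^-1) `|dst Z u - c|.
  by exists u => //; rewrite /u; apply/andP; split; lra.
exists v; first by rewrite /v; apply/andP; split; lra.
move: c4; rewrite du sub0r normrN ltr_norml => /andP[? ?].
rewrite ger0_norm; lra.
Qed.

Variables (e : nat -> R) (e0 : forall k, 0 < e k).

Let p := fix p k := if k is k'.+1 then Num.min (e k) (p k' / 512) else e 0%N.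

Let p_gt0 k : 0 < p k.
Proof.
elim: k => [|k IH]; first exact: e0.
have p512 : 0 < p k / 512 by apply: divr_gt0; [exact: IH|rewrite ltr0n].
by rewrite [p _]/(Num.min (e k.+1) (p k / 512)) lt_min e0 p512.
Qed.

Let p_le k : p k <= e k.
Proof. by case: k => [|k] //=; rewrite ge_min lexx. Qed.

Let g k t : R := 2^-1 / 16 ^+ k * dst Z (t / p k).

Let ge0 k : 0 < 2^-1 / 16 ^+ k :> R.
Proof. by rewrite divr_gt0 ?exprn_gt0// invr_gt0. Qed.

Let g_bound k t : `|g k t| <= 2^-1 / 2 ^+ k.
Proof.
rewrite normrM gtr0_norm// ger0_norm ?dst_ge0//.
apply: (@le_trans _ _ (2^-1 / 16 ^+ k)); first by rewrite ler_piMr ?dst_le1// ltW.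
rewrite ler_pM2l ?invr_gt0// lef_pV2 ?posrE ?exprn_gt0//.
by rewrite lerXn2r ?nnegrE// ler_nat.
Qed.

Let g_lipschitz k s t : `|g k t - g k s| <= 2^-1 / 16 ^+ k / p k * `|t - s|.
Proof.
rewrite -mulrBr normrM gtr0_norm// -mulrA ler_pM2l//.
apply: le_trans (dst_lipschitz _ _ _) _.
by rewrite -mulrBl normrM mulrC gtr0_norm// invr_gt0.
Qed.

(* The ratio 512 between consecutive periods, against 16 between amplitudes, makes
   the slower waves vary by at most [1/31] of the amplitude of the current one. *)
Let slope k : (\sum_(j < k) 2^-1 / 16 ^+ j / p j) * p k <= 2^-1 / 16 ^+ k / 31.
Proof.
elim: k => [|k IH]; first by rewrite big_ord0 mul0r !divr_ge0.
rewrite big_ord_recr/=; set S := \sum_(_ < _) _ in IH *.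
have S0 : 0 <= S by apply: sumr_ge0 => i _; rewrite divr_ge0 ?ltW.
apply: (@le_trans _ _ ((S + 2^-1 / 16 ^+ k / p k) * (p k / 512))).
  rewrite ler_wpM2l ?addr_ge0//; first by rewrite divr_ge0 ?ltW.
  by rewrite ge_min lexx orbT.
have -> : (S + 2^-1 / 16 ^+ k / p k) * (p k / 512) = (S * p k + 2^-1 / 16 ^+ k) / 512.
  by field; rewrite expf_neq0// gt_eqF.
have -> : 2^-1 / 16 ^+ k.+1 = 2^-1 / 16 ^+ k / 16 :> R.
  by rewrite exprS; field; rewrite expf_neq0.
have := ge0 k; lra.
Qed.

Let spread k b s : b <= s <= b + p k ->
  exists2 t, b <= t <= b + p k & 32^-1 / 16 ^+ k <= `|sum_fun g t - sum_fun g s|.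
Proof.
move=> /andP[bs sb].
have [v /andP[bv vb] vP] := dstZ_spread (b / p k) (dst Z (s / p k)).
have pk0 := p_gt0 k.
have ts : `|v * p k - s| <= p k.
  move: bv vb; rewrite ler_pdivrMr// -[X in _ <= _ + X](@divff _ (p k)) ?gt_eqF//.
  rewrite -mulrDl ler_pdivlMr// => bv vb.
  rewrite ler_norml; apply/andP; split; lra.
exists (v * p k).
  by rewrite -ler_pdivrMr// bv/= -ler_pdivlMr// mulrDl divff// gt_eqF.
have := @sum_fun_tail _ g _ (2^-1 / 8 ^+ k.+1) k.+1 s (v * p k) g_bound.
have H i : (k.+1 <= i)%N -> `|g i (v * p k) - g i s| <= 2^-1 / 8 ^+ k.+1 / 2 ^+ i.
  move=> ki; rewrite -mulrBr normrM gtr0_norm//.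
  apply: (@le_trans _ _ (2^-1 / 16 ^+ i)).
    rewrite ler_piMr ?(ltW (ge0 i))// ler_norml.
    have := dst_ge0 Z (v * p k / p i); have := dst_le1 Z (v * p k / p i).
    have := dst_ge0 Z (s / p i); have := dst_le1 Z (s / p i).
    by move=> *; apply/andP; split; lra.
  have -> : 16 ^+ i = 8 ^+ i * 2 ^+ i :> R by rewrite -exprMn -natrM.
  rewrite invfM mulrA ler_pM2r ?invr_gt0 ?exprn_gt0// ler_pM2l ?invr_gt0//.
  rewrite lef_pV2 ?posrE ?exprn_gt0// ler_weXn2l//.
  by rewrite ler1n.
move=> /(_ H) {H}.
have -> : 2 * (2^-1 / 8 ^+ k.+1) / 2 ^+ k.+1 = 2^-1 / 16 ^+ k / 8 :> R.
  have -> : 16 ^+ k = 8 ^+ k * 2 ^+ k :> R by rewrite -exprMn -natrM.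
  by rewrite !exprS; field; rewrite !expf_neq0.
rewrite big_ord_recr/=.
have low : `|\sum_(j < k) (g j (v * p k) - g j s)| <= 2^-1 / 16 ^+ k / 31.
  apply: le_trans (ler_norm_sum _ _ _) _.
  apply: le_trans _ (slope k); rewrite mulr_suml; apply: ler_sum => j _.
  apply: le_trans (g_lipschitz _ _ _) _.
  by rewrite ler_wpM2l// divr_ge0 ?ltW.
have top : 2^-1 / 16 ^+ k / 4 <= `|g k (v * p k) - g k s|.
  rewrite -mulrBr normrM gtr0_norm// ler_pM2l// mulfK// ?gt_eqF//.
have -> : 32^-1 / 16 ^+ k = 2^-1 / 16 ^+ k / 16 :> R by field; rewrite expf_neq0.
have := ge0 k; move: low top; set L := \sum_(_ < _) _; set G := g k _ - _.
set F := _ - sum_fun g s; set A := 2^-1 / _ => low top A0.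
have := ler_normD (F - (L + G)) (L - F).
have -> : F - (L + G) + (L - F) = - G by ring.
rewrite normrN.
have := ler_normB L F; lra.
Qed.

(** A function oscillating at every scale: the sum of triangle waves of
  amplitudes [16 ^- k / 2] and rapidly decreasing periods [p k <= e k].  On an
  interval whose length is the [k]-th period, the [k]-th wave beats both the
  slower waves, which are nearly constant there, and the total amplitude of the
  faster ones. *)
Lemma rough_function : exists w : R -> R, [/\ nearly_Lipschitz w, forall x, `|w x| <= 1,
  forall k s, exists2 t, s <= t <= s + e k & 32^-1 / 16 ^+ k <= `|w t - w s| &
  forall k s, exists2 t, s - e k <= t <= s & 32^-1 / 16 ^+ k <= `|w t - w s| ].
Proof.
exists (sum_fun g); split.
- apply: sum_fun_nearly_Lipschitz g_bound _ => k d d0.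
  exists (2^-1 / 16 ^+ k / p k) => [|x y]; first by rewrite divr_ge0 ?ltW.
  by apply: le_trans (g_lipschitz _ _ _) _; rewrite lerDr ltW.
- by move=> x; have := sum_fun_bound x g_bound; rewrite divff.
- move=> k s; have [|t /andP[st ts] tP] := @spread k s s.
    by rewrite lexx lerDl ltW.
  by exists t => //; rewrite st/=; apply: le_trans ts _; rewrite lerD2l.
- move=> k s; have [|t /andP[st ts] tP] := @spread k (s - p k) s.
    by rewrite subrK lexx gerBl ltW.
  exists t => //; move: ts; rewrite subrK => ->; rewrite andbT.
  by apply: le_trans st; rewrite lerD2l lerN2.
Qed.

End rough_function.

(** * Compact sets of positive measure around each of their points *)

Section mass.
Context {R : realType}.
Local Notation mu := (@lebesgue_measure R).
Implicit Types (S : set R) (x y : R).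

Definition mass S x : R := fine (mu (S `&` `]-oo, x])).

Lemma measurable_itvI S (i : interval R) : measurable S -> measurable (S `&` [set` i]).
Proof. by move=> mS; apply: measurableI => //; exact: measurable_itv. Qed.

Lemma measure_fin_numI S (A : set R) : measurable S -> measurable A -> (mu S < +oo)%E ->
  mu (S `&` A) \is a fin_num.
Proof.
move=> mS mA Soo; rewrite ge0_fin_numE ?measure_ge0//.
by apply: le_lt_trans Soo; apply: le_measure; rewrite ?inE//; exact: measurableI.
Qed.

Lemma massB S x y : measurable S -> (mu S < +oo)%E -> x <= y ->
  mass S y - mass S x = fine (mu (S `&` `]x, y])).
Proof.
move=> mS Soo xy.
have -> : mass S y = fine (mu (S `&` `]-oo, x]) + mu (S `&` `]x, y])).
  rewrite /mass -measureU//; last 3 first.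
  - exact: measurable_itvI.
  - exact: measurable_itvI.
  - rewrite -subset0 => z [[_ /= +] [_ /=]].
    by rewrite !in_itv/= => zx /andP[]; rewrite ltNge zx.
  rewrite -setIUr -itv_bndbnd_setU//.
by rewrite fineD ?measure_fin_numI// addrC addKr.
Qed.

Lemma mass_le S x y : measurable S -> (mu S < +oo)%E -> x <= y -> mass S x <= mass S y.
Proof. by move=> mS Soo xy; rewrite -subr_ge0 massB// fine_ge0. Qed.

Lemma mass_lipschitz S x y : measurable S -> (mu S < +oo)%E ->
  `|mass S x - mass S y| <= `|x - y|.
Proof.
move=> mS Soo; wlog xy : x y / x <= y.
  by have [/ltW yx H|yx] := ltP y x; [rewrite distrC [leRHS]distrC; apply: H|exact].
rewrite distrC [leRHS]distrC ger0_norm ?subr_ge0 ?mass_le// ger0_norm ?subr_ge0//.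
rewrite massB//; have fI : mu (S `&` `]x, y]) \is a fin_num by exact: measure_fin_numI.
rewrite -lee_fin fineK//.
apply: (@le_trans _ _ (mu `]x, y])).
  by apply: le_measure; rewrite ?inE//; exact: measurable_itvI.
rewrite lebesgue_measure_itv/= lte_fin; case: ifPn => // _.
by rewrite lee_fin subr_ge0.
Qed.

Lemma mass_nearly_Lipschitz S : measurable S -> (mu S < +oo)%E -> nearly_Lipschitz (mass S).
Proof.
move=> mS Soo e e0; exists 1 => // x y; rewrite mul1r.
by apply: le_trans (mass_lipschitz _ _ mS Soo) _; rewrite lerDr ltW.
Qed.

Lemma mass_bound S x : measurable S -> (mu S < +oo)%E -> `|mass S x| <= fine (mu S).
Proof.
move=> mS Soo; rewrite ger0_norm ?fine_ge0//; apply: fine_le.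
- exact: measure_fin_numI.
- by rewrite ge0_fin_numE.
- by apply: le_measure; rewrite ?inE//; exact: measurable_itvI.
Qed.

Lemma mass_const_off S : measurable S -> (mu S < +oo)%E -> const_off (mass S) S.
Proof.
move=> mS Soo x y xy Sxy; apply/esym/eqP; rewrite -subr_eq0 massB//.
rewrite (_ : _ `&` _ = set0) ?measure0//.
rewrite -subset0 => z [Sz /=]; rewrite in_itv/= => /andP[/ltW xz zy].
by apply: (Sxy z) => //; rewrite xz.
Qed.

End mass.

(** Oscillations need only be checked along the scales [64 ^- k]: their decay at
  the slower rate [16 ^- k] leaves room for the passage to the scales in between. *)
Lemma steep_scales {R : realType} (f : R -> R) (x c : R) (K : nat) : 0 < c ->
  (forall k, (K <= k)%N -> exists2 y, `|x - y| <= 1 / 64 ^+ k & c / 16 ^+ k <= `|f y - f x|) ->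
  steep f x.
Proof.
move=> c0 fc M M0.
have [m mP] : exists m, 1 / 2 ^+ m < c / (64 * M).
  by apply: half_expr_lt; rewrite divr_gt0// mulr_gt0.
pose N := maxn K m.
exists (1 / 64 ^+ N); first by rewrite divr_gt0// exprn_gt0.
move=> r /andP[r0 rN].
have ex : exists k, 1 / 64 ^+ k <= r.
  have [k kr] := half_expr_lt r0; exists k; apply: le_trans (ltW kr).
  by rewrite !mul1r lef_pV2 ?posrE ?exprn_gt0// lerXn2r ?nnegrE// ler_nat.
have := ex_minnP ex; case=> -[|k] kr kmin.
  move: rN; rewrite ltNge => /negP[]; apply: le_trans kr.
  by rewrite expr0 divr1 ler_pdivrMr ?exprn_gt0// mul1r exprn_ege1// ler1n.
have rk : r < 1 / 64 ^+ k by rewrite ltNge; apply/negP => /kmin; rewrite ltnn.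
have Nk : (N <= k)%N.
  rewrite -ltnS ltnNge; apply/negP => kN.
  have : 1 / 64 ^+ N <= r.
    apply: le_trans kr; rewrite !mul1r lef_pV2 ?posrE ?exprn_gt0//.
    by rewrite ler_weXn2l// ler1n.
  by rewrite leNgt rN.
have [|y xy fy] := fc k.+1.
  by rewrite leqW// (leq_trans _ Nk)// leq_maxl.
exists y; first exact: le_trans xy kr.
apply: le_trans fy; apply: (@le_trans _ _ (M * (1 / 64 ^+ k))); first by rewrite ler_wpM2l// ltW.
have H : 2 ^+ m <= 4 ^+ k :> R.
  apply: (@le_trans _ _ (4 ^+ m)); first by rewrite lerXn2r ?nnegrE// ler_nat.
  by rewrite ler_weXn2l ?ler1n// (leq_trans _ Nk)// leq_maxr.
have -> : 64 ^+ k = 16 ^+ k * 4 ^+ k :> R by rewrite -exprMn -natrM.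
rewrite exprS invfM mul1r invfM mulrCA [leRHS]mulrA [leLHS]mulrC ler_pM2r ?invr_gt0 ?exprn_gt0//.
rewrite ler_pdivrMr ?exprn_gt0//; move: mP H.
rewrite ltr_pdivlMr ?mulr_gt0// mulrAC ltr_pdivrMr ?exprn_gt0// mul1r => mP H.
have : c * 2 ^+ m <= c * 4 ^+ k by rewrite ler_pM2l.
lra.
Qed.

Definition fat {R : realType} (B : set R) : Prop :=
  forall x r, B x -> 0 < r -> (0 < @lebesgue_measure R (B `&` `](x - r)%R, (x + r)%R[))%E.

(** The mass function of [B] is constant off [B] and strictly increasing across
  each of its points, by an amount which is bounded below over [B] at each scale
  by compactness.  A rough function whose roughness beats that amount is still
  rough after composition with it. *)
Lemma fat_piece {R : realType} (B : set R) : compact B -> fat B ->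
  exists h, [/\ nearly_Lipschitz h, forall x, `|h x| <= 1, const_off h B &
    forall x, B x -> steep h x].
Proof.
move=> cB fB; pose G := mass B.
have mB : measurable B by apply: measurable_realfun.closed_measurable; exact: compact_closedR.
have Boo : (@lebesgue_measure R B < +oo)%E by exact: compact_finite_measure.
(* Half of the minimum over [B] of the mass of the balls of radius [1 / 64 ^+ k]. *)
have /choice[e eP] : forall k, exists e, 0 < e /\
    forall x, B x -> 2 * e <= G (x + 1 / 64 ^+ k) - G (x - 1 / 64 ^+ k).
  move=> k; set r := 1 / 64 ^+ k.
  have r0 : 0 < r by rewrite divr_gt0// exprn_gt0.
  have [->|/set0P B0] := eqVneq B set0; first by exists 1.
  have cF : continuous (fun x => G (x + r) - G (x - r)).
    apply: nearly_Lipschitz_continuous => d d0; exists 2 => // x y.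
    have := mass_lipschitz (x + r) (y + r) mB Boo; have := mass_lipschitz (x - r) (y - r) mB Boo.
    have -> : x - r - (y - r) = x - y by ring.
    have -> : x + r - (y + r) = x - y by ring.
    rewrite -/G => A A'.
    have -> : G (x + r) - G (x - r) - (G (y + r) - G (y - r)) =
      (G (x + r) - G (y + r)) - (G (x - r) - G (y - r)) by ring.
    by apply: le_trans (ler_normB _ _) _; lra.
  have [|c /[!inE] Bc cP] := compact_EVT_min B0 cB (_ : {within B, continuous (fun x => G (x + r) - G (x - r))}).
    exact: continuous_subspaceT.
  exists ((G (c + r) - G (c - r)) / 2); split; last first.
    by move=> x Bx; rewrite mulrC divfK//; apply: cP; rewrite inE.
  rewrite divr_gt0// massB//; last by move: r0; lra.
  apply: fine_gt0; apply/andP; split; last first.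
    by rewrite -ge0_fin_numE//; exact: measure_fin_numI.
  apply: lt_le_trans (fB _ _ Bc r0) _; apply: le_measure; rewrite ?inE.
  - exact: measurable_itvI.
  - exact: measurable_itvI.
  - by apply: setIS => z /=; rewrite !in_itv/= => /andP[-> /ltW].
have e0 k : 0 < e k by case: (eP k).
have [w [nw w1 wr wl]] := rough_function e0.
exists (w \o G); split => //=.
- move=> d d0; have [L L0 LP] := nw _ d0; exists L => // x y.
  apply: le_trans (LP _ _) _; rewrite lerD2l ler_wpM2l//.
  exact: mass_lipschitz.
- by move=> x y xy Bxy; rewrite /= /G (mass_const_off mB Boo xy Bxy).
- move=> x Bx; apply: (@steep_scales _ _ _ 32^-1 0%N) => [|k _]; first by rewrite invr_gt0.
  have [_ /(_ _ Bx)] := eP k; set r := 1 / _ => er.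
  have r0 : 0 < r by rewrite divr_gt0// exprn_gt0.
  have hit a b s : a <= b -> G a <= s <= G b -> exists2 y, a <= y <= b & G y = s.
    move=> ab /andP[as_ sb].
    have [||y] := @IVT _ G a b s ab.
    - apply: continuous_subspaceT; apply: nearly_Lipschitz_continuous.
      exact: mass_nearly_Lipschitz.
    - by rewrite ge_min le_max as_ sb orbT.
    - by rewrite in_itv/= => yab yG; exists y.
  (* One of the two halves of the ball carries half of its mass. *)
  have [er'|er'] := leP (e k) (G (x + r) - G x).
    have [t /andP[xt te] tP] := wr k (G x).
    have [||y /andP[xy yx] yt] := hit x (x + r) t; first by rewrite lerDl ltW.
      by rewrite xt/=; move: te er'; lra.
    exists y; last by rewrite /= yt.
    by rewrite ler0_norm; lra.
  have [t /andP[xt te] tP] := wl k (G x).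
  have [||y /andP[xy yx] yt] := hit (x - r) x t; first by rewrite gerBl ltW.
    by rewrite te andbT; move: xt er' er; lra.
  exists y; last by rewrite /= yt.
  by rewrite ger0_norm; lra.
Qed.

(** * Compact null sets *)

Lemma thin_neighborhood {R : realType} (E : set R) (e : R) : compact E ->
  @lebesgue_measure R E = 0%E -> 0 < e ->
  exists2 d, 0 < d <= e & (@lebesgue_measure R [set x | dst E x < d]%R <= e%:E)%E.
Proof.
move=> cE E0 e0; pose F n := [set x : R | dst E x < 1 / 2 ^+ n].
have mF n : measurable (F n) by apply: measurable_realfun.open_measurable; exact: open_dst_lt.
have [N N0 EN] := compact_within cE.
have F0oo : (@lebesgue_measure R (F 0%N) < +oo)%E.
  apply: (@le_lt_trans _ _ (@lebesgue_measure R `[- (N + 1), N + 1])).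
    apply: le_measure; rewrite ?inE; [exact: mF|exact: measurable_itv|].
    move=> x; rewrite /F/= expr0 divr1 => /dst_lt[//|a Ea xa].
    rewrite in_itv/= -ler_norml; have := EN a Ea; have := ler_normD (x - a) a.
    by rewrite subrK; lra.
  by apply: compact_finite_measure; exact: segment_compact.
have IF : \bigcap_n F n = E.
  apply/seteqP; split => [x Fx|x Ex n _]; last by rewrite /F/= dst_eq0// divr_gt0// exprn_gt0.
  apply: contrapT => /(dst_gt0 (compact_closedR cE)) d0.
  have [n nd] := half_expr_lt d0.
  by have := Fx n I; rewrite /F/= ltNge (ltW nd).
have ndF : {homo F : n m / (n <= m)%N >-> (m <= n)%O}.
  move=> n m nm; apply/subsetPset => x; rewrite /F/= => /lt_le_trans; apply.
  by rewrite !mul1r lef_pV2 ?posrE ?exprn_gt0// ler_weXn2l ?ler1n.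
have : @lebesgue_measure R (F n) @[n --> \oo] --> 0%E.
  by rewrite -E0 -IF; exact: nonincreasing_cvg_mu F0oo mF (bigcapT_measurable mF) ndF.
move=> /fine_cvgP[fF /cvgrPdist_lt /(_ e e0) cF].
have [m me] := half_expr_lt e0.
have [n _ nP] : \forall n \near \oo, [/\ (@lebesgue_measure R (F n) \is a fin_num),
    `|0 - fine (@lebesgue_measure R (F n))| < e & 1 / 2 ^+ n < e].
  near=> n; split; [by near: n|by near: n|].
  apply: le_lt_trans me.
  rewrite !mul1r lef_pV2 ?posrE ?exprn_gt0// ler_weXn2l ?ler1n//.
  by near: n; exists m.
have [fn + ne] := nP n (leqnn n).
rewrite sub0r normrN => nE.
exists (1 / 2 ^+ n); first by rewrite divr_gt0 ?exprn_gt0//= ltW.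
rewrite -[leLHS](fineK fn) lee_fin; apply: le_trans (ltW nE).
exact: ler_norm.
Unshelve. all: by end_near. Qed.

Lemma sum_fun_const_off {R : realType} (h : nat -> R -> R) (T : set R) :
  (forall i, const_off (h i) T) -> const_off (sum_fun h) T.
Proof.
move=> hT x y xy Txy; rewrite /sum_fun (_ : h^~ x = h^~ y)//.
by apply/funext => i; exact: hT.
Qed.

Lemma const_offS {R : realType} (h : R -> R) (S T : set R) : S `<=` T ->
  const_off h S -> const_off h T.
Proof. by move=> ST hS x y xy Txy; apply: hS => // t /Txy Tt /ST. Qed.

Lemma measurable_dst_lt {R : realType} (A : set R) (e : R) :
  measurable [set x | dst A x < e].
Proof. by apply: measurable_realfun.open_measurable; exact: open_dst_lt. Qed.

(** Summing the mass functions of neighbourhoods of [E] of summable measures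
  gives a function with infinite derivative on [E], as a point of [E] lies in the
  interior of all the neighbourhoods.  Removing [W] at most halves the growth at the
  points of [E], as [W] is thin there, and makes the sum constant on [W]. *)
Lemma null_piece {R : realType} (E W : set R) (d : R) : compact E ->
  @lebesgue_measure R E = 0%E -> 0 < d -> open W ->
  (forall x r : R, E x -> 0 < r ->
    (@lebesgue_measure R (W `&` `]x, (x + r)%R]) <= (r / 2)%:E)%E) ->
  exists h, [/\ nearly_Lipschitz h, forall x, `|h x| <= 1,
    const_off h ([set x | dst E x <= d] `\` W),
    forall x, E x -> steep h x & forall x, ~ E x -> tame h x].
Proof.
move=> cE E0 d0 oW thin.
have mW : measurable W by exact: measurable_realfun.open_measurable.
have /choice[e eP] : forall k, exists e, [/\ 0 < e, e <= d, e <= 1 / 2 ^+ k &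
    (@lebesgue_measure R [set x | dst E x < e]%R <= (2^-1 / 2 ^+ k)%:E)%E].
  move=> k; have [|e /andP[e0 ek] ee] := @thin_neighborhood _ E (Num.min d (2^-1 / 2 ^+ k)) cE E0.
    by rewrite lt_min d0/= divr_gt0// ?exprn_gt0// invr_gt0.
  have k0 : 0 < (2 ^+ k)^-1 :> R by rewrite invr_gt0 exprn_gt0.
  move: ek; rewrite le_min => /andP[ed ek]; exists e; split => //.
    by apply: le_trans ek _; lra.
  by apply: le_trans ee _; rewrite lee_fin ge_min lexx orbT.
pose S k := [set x | dst E x < e k] `\` W.
have mS k : measurable (S k) by apply: measurableD => //; exact: measurable_dst_lt.
have S_le k : (@lebesgue_measure R (S k) <= (2^-1 / 2 ^+ k)%:E)%E.
  have [_ _ _] := eP k; apply: le_trans; apply: le_measure; rewrite ?inE.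
  - exact: mS.
  - exact: measurable_dst_lt.
  - exact: subDsetl.
have Soo k : (@lebesgue_measure R (S k) < +oo)%E by apply: le_lt_trans (S_le k) _; rewrite ltry.
pose g k := mass (S k).
have g_bound k x : `|g k x| <= 2^-1 / 2 ^+ k.
  apply: le_trans (mass_bound _ (mS k) (Soo k)) _.
  by rewrite -lee_fin fineK// ge0_fin_numE.
exists (sum_fun g); split.
- apply: sum_fun_nearly_Lipschitz g_bound _ => k; exact: mass_nearly_Lipschitz.
- by move=> x; have := sum_fun_bound x g_bound; rewrite divff.
- apply: sum_fun_const_off => k; apply: const_offS (mass_const_off (mS k) (Soo k)).
  by move=> x [/= xe Wx]; split => //=; have [_ ed _ _] := eP k; rewrite ltW// (lt_le_trans xe).
- move=> x Ex M M0.
  have [n nM] : exists n : nat, 2 * M <= n%:R.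
    by exists (Num.truncn (2 * M)).+1; apply/ltW; rewrite truncnS_gt.
  have [a a0 aP] : exists2 a, 0 < a & forall j, (j < n)%N -> a <= e j.
    elim: n {nM} => [|n [a a0 IH]]; first by exists 1.
    have [en _ _ _] := eP n.
    exists (Num.min a (e n)) => [|j]; first by rewrite lt_min a0.
    rewrite ltnS leq_eqVlt => /orP[/eqP->|/IH ja]; rewrite ge_min ?lexx ?orbT//.
    by rewrite ja.
  exists a => // r /andP[r0 ra]; exists (x + r).
    by rewrite opprD addrA subrr add0r normrN gtr0_norm.
  have xr : x <= x + r by rewrite lerDl ltW.
  have [cv ->] := sum_funB x (x + r) g_bound.
  have ge0 i : 0 <= g i (x + r) - g i x by rewrite subr_ge0; exact: mass_le.
  apply: le_trans (ler_norm _); apply: le_trans (@lim_series_ge _ _ n cv (fun i _ => ge0 i)).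
  apply: (@le_trans _ _ (\sum_(i < n) r / 2)).
    rewrite sumr_const card_ord -mulr_natr.
    by move: nM r0; nra.
  apply: ler_sum => i _; rewrite massB//.
  have fI : @lebesgue_measure R (S i `&` `]x, x + r]) \is a fin_num by exact: measure_fin_numI.
  rewrite -lee_fin fineK//.
  have -> : S i `&` `]x, x + r] = `]x, x + r] `\` W.
    apply/seteqP; split => t [].
      by move=> [_ Wt] xt; split.
    move=> xt Wt; split => //; split => //=.
    move: xt; rewrite /= in_itv/= => /andP[xt tx].
    apply: le_lt_trans (dst_le _ Ex) _; rewrite gtr0_norm ?subr_gt0//.
    by apply: lt_le_trans (aP i (ltn_ord i)); apply: le_lt_trans ra; lra.
  have mI : @lebesgue_measure R `]x, x + r] = r%:E.
    by rewrite lebesgue_measure_itv/= lte_fin ltrDl r0 -EFinB addrAC subrr add0r.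
  have mD : @lebesgue_measure R (`]x, x + r] `\` W) =
      (@lebesgue_measure R `]x, (x + r)%R] -
       @lebesgue_measure R (`]x, (x + r)%R] `&` W))%E.
    apply: measureD => //.
    by change (@lebesgue_measure R `]x, (x + r)%R] < +oo)%E; rewrite mI ltry.
  rewrite mD mI setIC; have := thin x r Ex r0.
  case: (@lebesgue_measure R (W `&` _)) => [s| |]//=.
  by rewrite -EFinB !lee_fin; lra.
- move=> x Ex; have a0 := dst_gt0 (compact_closedR cE) Ex.
  have [|n nP] := @half_expr_lt _ (dst E x / 2); first by rewrite divr_gt0.
  exists n%:R, (dst E x / 2) => [|y xy]; first by rewrite divr_gt0.
  have := @sum_fun_tail _ g _ 0 n x y g_bound.
  rewrite mulr0 !mul0r normr_le0 subr_eq0 => H.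
  have /eqP -> : sum_fun g y - sum_fun g x == \sum_(i < n) (g i y - g i x).
    apply: H => i ni.
    rewrite (@const_off_ball _ (g i) (S i) x (dst E x / 2)) ?subrr ?normr0 ?mul0r//.
      exact: mass_const_off.
    move=> t [/= te _]; have [_ _ ei _] := eP i.
    have : 1 / 2 ^+ i <= 1 / 2 ^+ n :> R.
      by rewrite !mul1r lef_pV2 ?posrE ?exprn_gt0// ler_weXn2l ?ler1n.
    have := dst_lipschitz E x t; have := ler_norm (dst E x - dst E t).
    by move: te ei nP; lra.
  apply: le_trans (ler_norm_sum _ _ _) _.
  apply: (@le_trans _ _ (\sum_(i < n) `|x - y|)).
    by apply: ler_sum => i _; rewrite [leRHS]distrC; exact: mass_lipschitz.
  by rewrite sumr_const card_ord mulr_natl.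
Qed.

(** * Disjoint compact pieces, fat or null *)

Lemma dst_ge {R : realType} (A : set R) (x a : R) : a <= 1 ->
  (forall y, A y -> a <= `|x - y|) -> a <= dst A x.
Proof.
move=> a1 Aa; apply: lb_le_inf; first by exists 1; left.
by move=> _ [->//|[y Ay <-]]; exact: Aa.
Qed.

Lemma compact_closed_apart {R : realType} (C Q : set R) : compact C -> closed Q ->
  C `&` Q = set0 -> exists2 a, 0 < a <= 1 & forall x, Q x -> a <= dst C x.
Proof.
move=> cC cQ CQ; have [a a0 aP] := compact_closed_dst cC cQ CQ.
exists (Num.min a 1); first by rewrite lt_min a0 ltr01/= ge_min lexx orbT.
move=> x Qx; apply: dst_ge => [|y Cy]; first by rewrite ge_min lexx orbT.
rewrite ge_min; apply/orP; left; apply: le_trans (aP _ Cy) _.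
by rewrite distrC; exact: dst_le.
Qed.

(** For each [i], a distance [D i] which separates [C i] from the earlier pieces, and
  from the complement of [V] if [C i] is null, and the radius [d i] of a neighbourhood
  of [C i] whose measure is negligible compared to [D i]. *)
Section pieces.
Context {R : realType} (C : nat -> set R) (V : set R) (b : nat -> bool).
Local Notation mu := (@lebesgue_measure R).
Hypothesis cC : forall i, compact (C i).
Hypothesis dC : forall i j, i != j -> C i `&` C j = set0.
Hypothesis oV : open V.
Hypothesis C_fat : forall i, b i -> fat (C i) /\ C i `&` V = set0.
Hypothesis C_null : forall i, ~~ b i -> mu (C i) = 0%E /\ C i `<=` V.

Lemma pieces_radii i : exists Dd : R * R, [/\ 0 < Dd.2, 2 * Dd.2 <= Dd.1 <= 1,
  forall j x, (j < i)%N -> C j x -> Dd.1 <= dst (C i) x,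
  ~~ b i -> forall x, ~ V x -> Dd.1 <= dst (C i) x &
  ~~ b i -> (mu [set x | dst (C i) x < Dd.2]%R <= (Dd.1 / 4 / (2 ^ i.+1)%:R)%:E)%E].
Proof.
have cQ : closed (\bigcup_(j in `I_i) C j `|` (if b i then set0 else ~` V)).
  apply: closedU; last by case: (b i); [exact: closed0|exact: open_closedC].
  apply: closed_bigcup => [|j _]; first exact: finite_II.
  exact: compact_closedR.
have [|D /andP[D0 D1] DP] := compact_closed_apart (@cC i) cQ.
  rewrite -subset0 => x [Cx [[j /= ji Cj]|]].
    have : (C i `&` C j) x by []. by rewrite dC// gtn_eqF.
  by case: (boolP (b i)) => // bi; apply; have [_] := C_null bi; exact.
have DC j x : (j < i)%N -> C j x -> D <= dst (C i) x by move=> ji Cx; apply: DP; left; exists j.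
have DV : ~~ b i -> forall x, ~ V x -> D <= dst (C i) x.
  by move=> bi x Vx; apply: DP; right; rewrite (negbTE bi).
have [bi|bi] := boolP (b i).
  by exists (D, D / 2); split => /=; [lra|apply/andP; split; lra|exact: DC| |].
have [|d /andP[d0 dD] dmu] := @thin_neighborhood _ (C i) (D / 4 / (2 ^ i.+1)%:R) (@cC i) (C_null bi).1.
  by rewrite !divr_gt0// ltr0n expn_gt0.
have H : D / 4 / (2 ^ i.+1)%:R <= D / 4.
  by rewrite ler_pdivrMr ?ltr0n ?expn_gt0// ler_peMr ?ler1n ?expn_gt0//; lra.
exists (D, d); split => /=; [exact: d0|apply/andP; split; lra|exact: DC|by move=> _; exact: DV|by []].
Qed.

Variables (D d : nat -> R).
Hypothesis d_gt0 : forall i, 0 < d i.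
Hypothesis D_le1 : forall i, 2 * d i <= D i <= 1.
Hypothesis DC : forall i j x, (j < i)%N -> C j x -> D i <= dst (C i) x.
Hypothesis DV : forall i, ~~ b i -> forall x, ~ V x -> D i <= dst (C i) x.
Hypothesis d_mu : forall i, ~~ b i ->
  (mu [set x | dst (C i) x < d i]%R <= (D i / 4 / (2 ^ i.+1)%:R)%:E)%E.

Let Y i := [set x | dst (C i) x < d i].

Let W i := \bigcup_(j in [set j | (i < j)%N && ~~ b j]) Y j.

Let oW i : open (W i).
Proof. by apply: bigcup_open => j _; exact: open_dst_lt. Qed.

(* The interval only meets the neighbourhoods [Y j] of radius [d j] with [r >= D j / 2],
   by the choice of [d j], and the measures of those sum to at most [r / 2]. *)
Let W_thin i (x r : R) : C i x -> 0 < r -> (mu (W i `&` `]x, (x + r)%R]) <= (r / 2)%:E)%E.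
Proof.
move=> Cx r0; pose F j := (if (i < j)%N && ~~ b j then Y j else set0) `&` `]x, x + r].
have mF j : measurable (F j).
  apply: measurable_itvI; case: ifP => // _; exact: measurable_dst_lt.
apply: (@le_trans _ _ (\sum_(0 <= j <oo) mu (F j))%E).
  apply: measure_sigma_subadditive => //.
    by apply: measurable_itvI; apply: measurable_realfun.open_measurable; exact: oW.
  by move=> t [[j /= jP Yt] xt]; exists j => //; split => //; rewrite jP.
apply: le_trans (epsilon_trick0 xpredT (_ : 0 <= r / 2)); last by rewrite divr_ge0// ltW.
apply: lee_nneseries => // j _.
have k0 : 0 < (2 ^ j.+1)%:R :> R by rewrite ltr0n expn_gt0.
have [F0|/set0P[t [Yt /= xt]]] := eqVneq (F j) set0.
  by rewrite F0 measure0 lee_fin !divr_ge0// ?ltW.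
move: Yt; case: ifP => // /andP[ij bj] Yt.
apply: (@le_trans _ _ (mu (Y j))).
  apply: le_measure; rewrite ?inE.
  - exact: mF.
  - exact: measurable_dst_lt.
  - by move=> z [] + _; rewrite ij bj.
apply: le_trans (d_mu bj) _; rewrite lee_fin ler_pM2r ?invr_gt0//.
move: xt Yt; rewrite in_itv/= /Y/= => /andP[xt tx] tY.
have := DC ij Cx; have := dst_lipschitz (C j) x t; have := ler_norm (dst (C j) x - dst (C j) t).
have /andP[] := D_le1 j.
rewrite [`|x - t|]ler0_norm; lra.
Qed.

(* The set off which the i-th function is constant. *)
Let T i := if b i then C i else [set x | dst (C i) x <= d i / 2] `\` W i.

Let TV i x : ~~ b i -> T i x -> V x.
Proof.
move=> bi; rewrite /T (negbTE bi) => -[/= xd _]; apply: contrapT => /(DV bi).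
by have := d_gt0 i; have := D_le1 i; lra.
Qed.

Let cT i : compact (T i).
Proof.
rewrite /T; case: (boolP (b i)) => // bi.
have [N N0 NC] := compact_within (@cC i).
apply: (@closed_within_compact _ _ (N + 1)) => [|x [/= xd _]].
  by apply: closedI; [exact: closed_dst_le|apply: open_closedC; exact: oW].
have [||a /NC aN xa] := @dst_lt _ (C i) x 1 => //.
  by have := d_gt0 i; have := D_le1 i; lra.
by have := ler_normD (x - a) a; rewrite subrK; lra.
Qed.

Let dT i j : i != j -> T i `&` T j = set0.
Proof.
wlog ji : i j / (j < i)%N.
  by move=> H; have [ij|ji|->] := ltngtP i j; 
    [by move=> _; rewrite setIC; apply: H; rewrite ?gtn_eqF|by move=> _; apply: H; rewrite ?gtn_eqF|].
move=> ij; rewrite -subset0 => x [Tix Tjx].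
have := d_gt0 i; have /andP[Di _] := D_le1 i.
case: (boolP (b i)) => bi; case: (boolP (b j)) => bj.
- have : (C i `&` C j) x by move: Tix Tjx; rewrite /T bi bj.
  by rewrite dC.
- have : (C i `&` V) x by split; [move: Tix; rewrite /T bi|exact: TV Tjx].
  by have [_ ->] := C_fat bi.
- move: Tix Tjx; rewrite /T (negbTE bi) bj => -[/= xd _] /(DC ji); lra.
- move: Tix Tjx; rewrite /T (negbTE bi) (negbTE bj) => -[/= xd _] [_ Wx] d0.
  by case: Wx; exists i; rewrite /= ?ji ?bi// /Y/=; lra.
Qed.

Let CT i x : C i x -> T i x.
Proof.
move=> Cx; rewrite /T; case: (boolP (b i)) => // bi; split.
  by rewrite /= dst_eq0// divr_ge0// ltW.
move=> [j /= /andP[ij bj]]; rewrite /Y/=.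
by have := DC ij Cx; have := d_gt0 j; have := D_le1 j; lra.
Qed.

Let piece i : exists h, [/\ nearly_Lipschitz h, forall x, `|h x| <= 1, const_off h (T i) &
  forall x, T i x -> (steep h x <-> C i x)].
Proof.
rewrite /T; have [bi|bi] := boolP (b i).
  have [h [nh h1 hT hs]] := fat_piece (@cC i) (C_fat bi).1.
  by exists h; split => // x Cx; split => // _; exact: hs.
have d2 : 0 < d i / 2 by rewrite divr_gt0.
have [h [nh h1 hT hs ht]] := null_piece (@cC i) (C_null bi).1 d2 (@oW i) (@W_thin i).
exists h; split => // x _; split => [sx|]; last exact: hs.
by apply: contrapT => /ht /tame_not_steep.
Qed.

Lemma steep_disjoint_pieces_radii : exists2 f, nearly_Lipschitz f & forall x, steep f x <-> exists i, C i x.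
Proof.
have /choice[h hP] := piece.
have nh i : nearly_Lipschitz (h i) by case: (hP i).
have h1 i x : `|h i x| <= 1 by case: (hP i).
have hT i : const_off (h i) (T i) by case: (hP i).
have hC i x : T i x -> (steep (h i) x <-> C i x) by case: (hP i) => _ _ _; apply.
have [f [nf fT f0]] := @gluing _ T h cT dT nh h1 hT.
exists f => // x; split => [sx|[i Cx]]; last first.
  have Tx : T i x by exact: CT.
  by apply/(fT i x Tx)/(hC i x Tx).
have [i Tx] : exists i, T i x by apply: contrapT => /forallNP /f0.
by exists i; apply/(hC i x Tx)/(fT i x Tx).
Qed.

End pieces.

(** The pieces which are not fat are null and contained in an open set [V] that the
  fat pieces avoid: thus the extra points of the set where the function of a null
  piece varies belong to no piece at all. *)
Lemma steep_disjoint_pieces {R : realType} (C : nat -> set R) (V : set R) (b : nat -> bool) :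
  (forall i, compact (C i)) -> (forall i j, i != j -> C i `&` C j = set0) -> open V ->
  (forall i, b i -> fat (C i) /\ C i `&` V = set0) ->
  (forall i, ~~ b i -> @lebesgue_measure R (C i) = 0%E /\ C i `<=` V) ->
  exists2 f, nearly_Lipschitz f & forall x, steep f x <-> exists i, C i x.
Proof.
move=> cC dC oV Cf Cn; have /choice[r rP] := pieces_radii cC dC oV Cn.
apply: (@steep_disjoint_pieces_radii _ C V b cC dC Cf Cn (fun i => (r i).1) (fun i => (r i).2)) => i;
  by case: (rP i).
Qed.

(** * Cutting a set into pieces *)

Section null_part.
Context {R : realType}.
Local Notation mu := (@lebesgue_measure R).
Implicit Types (S A Q : set R) (x r : R).

Definition rat_itv (n : nat) : set R :=
  if unpickle n is Some (p, q) then `](@ratr R p), (ratr q)[ else set0.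

Lemma open_rat_itv n : open (rat_itv n).
Proof.
rewrite /rat_itv; case: (unpickle n) => [[p q]|]; last exact: open0.
exact: interval_open.
Qed.

Lemma rat_itv_basis x r : 0 < r ->
  exists2 n, rat_itv n x & rat_itv n `<=` `]x - r, x + r[.
Proof.
move=> r0; have [|p] := @rat_in_itvoo R (x - r) x; first lra.
have [|q] := @rat_in_itvoo R x (x + r); first lra.
rewrite !in_itv/= => /andP[xq qr] /andP[rp px].
exists (pickle (p, q)); rewrite /rat_itv pickleK /=; first by rewrite in_itv/= px.
by move=> t /=; rewrite !in_itv/= => /andP[pt tq]; apply/andP; split; lra.
Qed.

Lemma open_ball_itv (O : set R) x : open O -> O x ->
  exists2 r, 0 < r & `]x - r, x + r[ `<=` O.
Proof.
move=> oO Ox; have [r /= r0 rO] := (nbhs_ballP _ _).1 (open_nbhs_nbhs (conj oO Ox)).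
by exists r => // y xy; apply: rO; rewrite ball_itv.
Qed.

(** The largest open set in which [S] is null, written as a countable union so that
  [S] is null in it as a whole. *)
Definition null_part S : set R :=
  \bigcup_(n in [set n | mu (S `&` rat_itv n) = 0%E]) rat_itv n.

Lemma open_null_part S : open (null_part S).
Proof. by apply: bigcup_open => n _; exact: open_rat_itv. Qed.

Lemma measurable_rat_itvI S n : measurable S -> measurable (S `&` rat_itv n).
Proof.
move=> mS; apply: measurableI => //.
by apply: measurable_realfun.open_measurable; exact: open_rat_itv.
Qed.

Lemma null_null_part S : measurable S -> mu (S `&` null_part S) = 0%E.
Proof.
move=> mS; have mV : measurable (S `&` null_part S).
  by apply: measurableI => //; apply: measurable_realfun.open_measurable; exact: open_null_part.
apply/eqP; rewrite eq_le measure_ge0 andbT.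
pose G n := if `[< mu (S `&` rat_itv n) = 0%E >] then S `&` rat_itv n else set0.
have mG n : measurable (G n) by rewrite /G; case: ifP => // _; exact: measurable_rat_itvI.
have G0 n : mu (G n) = 0%E by rewrite /G; case: ifPn => [/asboolP//|_]; rewrite measure0.
apply: (@le_trans _ _ (\sum_(0 <= n <oo) mu (G n))%E).
  apply: measure_sigma_subadditive => // x [Sx [n /= n0 nx]]; exists n => //.
  by rewrite /G asboolT.
by rewrite eseries0// => n _ _; exact: G0.
Qed.

Lemma null_partPn S x r : measurable S -> ~ null_part S x -> 0 < r ->
  (0 < mu (S `&` `](x - r)%R, (x + r)%R[))%E.
Proof.
move=> mS Sx r0; have [n nx nr] := rat_itv_basis x r0.
rewrite lt_neqAle measure_ge0 andbT eq_sym; apply/eqP => S0.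
apply: Sx; exists n => //=; apply: subset_measure0 S0 => //.
- exact: measurable_rat_itvI.
- exact: measurable_itvI.
- exact: setIS.
Qed.

(** Removing the null part changes no measure, hence leaves a set which is fat. *)
Lemma fat_kernel Q : closed Q -> closed (Q `\` null_part Q) /\ fat (Q `\` null_part Q).
Proof.
move=> cQ; have mQ : measurable Q by exact: measurable_realfun.closed_measurable.
have cK : closed (Q `\` null_part Q).
  by apply: closedI => //; apply: open_closedC; exact: open_null_part.
have mK : measurable (Q `\` null_part Q) by exact: measurable_realfun.closed_measurable.
split => // x r [_ Qx] r0; rewrite lt_neqAle measure_ge0 andbT eq_sym; apply/eqP => K0.
have := null_partPn mQ Qx r0; rewrite ltNge => /negP; apply.
have mN : measurable (Q `&` null_part Q).
  by apply: measurableI => //; apply: measurable_realfun.open_measurable; exact: open_null_part.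
have <- : (mu ((Q `\` null_part Q) `&` `](x - r)%R, (x + r)%R[) + mu (Q `&` null_part Q))%E = 0%E.
  by rewrite K0 add0e; exact: null_null_part.
apply: le_trans (measureU2 _ _ _) => //; last exact: measurable_itvI.
apply: le_measure; rewrite ?inE.
- exact: measurable_itvI.
- by apply: measurableU => //; exact: measurable_itvI.
- by move=> t [Qt xt]; have [Nt|Nt] := pselect (null_part Q t); [right|left].
Qed.

(** Around a point of [D], which is not in the null part of the union of the [F n], one
  of these closed sets has positive measure.  For each rational interval, such a
  closed set is chosen and its portion close to [D] is added to [D]; the portions shrink
  to [D], so that their union with [D] is closed. *)
Lemma fat_envelope (F : nat -> set R) (D : set R) : (forall n, closed (F n)) -> closed D ->
  D `<=` (\bigcup_n F n) `\` null_part (\bigcup_n F n) ->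
  exists A, [/\ closed A, fat A, D `<=` A & A `<=` (\bigcup_n F n) `\` null_part (\bigcup_n F n)].
Proof.
move=> cF cD; set S := \bigcup_n F n => DS.
have mF n : measurable (F n) by exact: measurable_realfun.closed_measurable.
have mS : measurable S by exact: bigcupT_measurable.
pose N i := rat_itv i `&` [set x | dst D x < 1 / 2 ^+ i].
have oN i : open (N i) by apply: openI; [exact: open_rat_itv|exact: open_dst_lt].
have mN i : measurable (N i) by exact: measurable_realfun.open_measurable.
have mFN n i : measurable (F n `&` N i) by exact: measurableI (mF n) (mN i).
have mSN i : measurable (S `&` N i) by exact: measurableI mS (mN i).
have /choice[j jP] : forall i, exists j, mu (S `&` N i) <> 0%E -> mu (F j `&` N i) <> 0%E.
  move=> i; have [[j Fj]|F0] := pselect (exists j, mu (F j `&` N i) <> 0%E); first by exists j.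
  exists 0%N => S0; exfalso; apply: S0; apply/eqP; rewrite eq_le measure_ge0 andbT.
  apply: (@le_trans _ _ (\sum_(0 <= n <oo) mu (F n `&` N i))%E).
    apply: measure_sigma_subadditive; [by move=> n; exact: mFN|exact: mSN|].
    by move=> x [[n _ Fx] Nx]; exists n.
  rewrite eseries0// => n _ _; apply: contrapT => Fn; apply: F0; by exists n.
pose P i := F (j i) `&` [set x | dst D x <= 1 / 2 ^+ i].
(* [Q] is the union of [D] and the [P i]; in this form it is visibly closed. *)
pose Q := \bigcap_k ((\bigcup_(i in `I_k) P i) `|` [set x | dst D x <= 1 / 2 ^+ k]).
have pow_ge0 k : 0 < 1 / 2 ^+ k :> R by rewrite divr_gt0// exprn_gt0.
have DQ : D `<=` Q by move=> x Dx k _; right; rewrite /= dst_eq0// ltW.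
have PQ i : P i `<=` Q.
  move=> x Px k _; have [ik|ki] := ltnP i k; first by left; exists i.
  right; case: Px => _ /= /le_trans; apply.
  by rewrite !mul1r lef_pV2 ?posrE ?exprn_gt0// ler_weXn2l ?ler1n.
have QS : Q `<=` S.
  move=> x Qx; have [Dx|Dx] := pselect (D x); first by have [] := DS x Dx.
  have [k kD] := half_expr_lt (dst_gt0 cD Dx).
  have [[i _ [Fx _]]|/=] := Qx k I; first by exists (j i).
  by rewrite leNgt kD.
have cQ : closed Q.
  apply: closed_bigI => k _; apply: closedU; last exact: closed_dst_le.
  apply: closed_bigcup => [|i _]; first exact: finite_II.
  by apply: closedI => //; exact: closed_dst_le.
have mQ : measurable Q by exact: measurable_realfun.closed_measurable.
have [cA fA] := fat_kernel cQ.
exists (Q `\` null_part Q); split => // [x Dx|x [Qx Nx]].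
- split; first exact: DQ.
  move=> [n /= n0 nx].
  have [r r0 rn] := open_ball_itv (@open_rat_itv n) nx.
  have [i ix ir] := rat_itv_basis x r0.
  have Nix : N i x by split => //=; rewrite dst_eq0.
  have [e e0 eN] := open_ball_itv (@oN i) Nix.
  have /jP : mu (S `&` N i) <> 0%E.
    move=> S0; have [_ Sx] := DS x Dx; have := null_partPn mS Sx e0.
    rewrite lt_neqAle => /andP[/eqP + _]; apply; apply/esym; apply: subset_measure0 S0.
    - exact: measurable_itvI.
    - exact: mSN.
    - exact: setIS.
  apply; apply: subset_measure0 n0; first exact: mFN.
    exact: measurable_rat_itvI.
  move=> t [Ft [it /= dt]]; split; last by apply: rn; exact: ir.
  by apply: (PQ i); split => //=; exact: ltW.
- split; first exact: QS.
  move=> [n /= n0 nx]; apply: Nx; exists n => //=; apply: subset_measure0 n0.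
  + exact: measurable_rat_itvI.
  + exact: measurable_rat_itvI.
  + exact: setSI.
Qed.

Lemma fat_openI Q O : measurable Q -> fat Q -> open O -> fat (Q `&` O).
Proof.
move=> mQ fQ oO x r [Qx Ox] r0; have [e e0 eO] := open_ball_itv oO Ox.
have m0 : 0 < Num.min r e by rewrite lt_min r0.
apply: lt_le_trans (fQ x _ Qx m0) _; apply: le_measure; rewrite ?inE.
- exact: measurable_itvI.
- apply: measurable_itvI; apply: measurableI => //.
  exact: measurable_realfun.open_measurable.
- have mr : Num.min r e <= r by rewrite ge_min lexx.
  have me : Num.min r e <= e by rewrite ge_min lexx orbT.
  move=> t [Qt /=]; rewrite in_itv/= => /andP[xt tx].
  split; first by split => //; apply: eO; rewrite /= in_itv/=; apply/andP; split; lra.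
  by rewrite /= in_itv/=; apply/andP; split; lra.
Qed.

Lemma fat_bigcup (D : set nat) (A : nat -> set R) : finite_set D ->
  (forall n, closed (A n)) -> (forall n, fat (A n)) -> fat (\bigcup_(n in D) A n).
Proof.
move=> fD cA fA x r [n Dn Ax] r0; apply: lt_le_trans (fA n x r Ax r0) _.
apply: le_measure; rewrite ?inE.
- by apply: measurable_itvI; exact: measurable_realfun.closed_measurable.
- by apply: measurable_itvI; apply: measurable_realfun.closed_measurable; exact: closed_bigcup.
- by apply: setSI; exact: bigcup_sup.
Qed.

End null_part.

(** The cut points do not belong to [S], so that in [S] the intervals [c i] are both
  open and closed.  The pieces of [H n.+1 \ H n] are the traces on [H n.+1] of those
  intervals which miss [H n], each one deprived of the previous ones. *)
Section disjoint_pieces.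
Context {R : realType} (S : set R) (H : nat -> set R).
Hypothesis cut : forall a b, a < b -> exists2 c, a < c < b & ~ S c.
Hypothesis cH : forall n, closed (H n).
Hypothesis ndH : forall m n, (m <= n)%N -> H m `<=` H n.
Hypothesis HS : forall n x, H n x -> ~ H 0%N x -> S x.

Lemma cut_intervals : exists c : nat -> R * R, (forall i, ~ S (c i).1 /\ ~ S (c i).2) /\
  forall x r, 0 < r -> exists i, [/\ x - r < (c i).1, (c i).1 < x, x < (c i).2 & (c i).2 < x + r].
Proof.
have /choice[c cP] : forall t : (rat * rat) * (rat * rat), exists c : R * R,
    [/\ ~ S c.1, ~ S c.2, (t.1.1 < t.1.2 -> ratr t.1.1 < c.1 < ratr t.1.2) &
     (t.2.1 < t.2.2 -> ratr t.2.1 < c.2 < ratr t.2.2)].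
  move=> [t1 t2].
  have H1 (t : rat * rat) : exists c, ~ S c /\ (t.1 < t.2 -> ratr t.1 < c < ratr t.2).
    have [lt12|le21] := ltP t.1 t.2.
      have /cut[c ct Sc] : ratr t.1 < ratr t.2 :> R by rewrite ltr_rat.
      by exists c.
    have [c _ Sc] := @cut 0 1 ltr01.
    by exists c.
  have [c1 [? ?]] := H1 t1; have [c2 [? ?]] := H1 t2.
  by exists (c1, c2).
exists (fun n => c (odflt ((0, 0), (0, 0)) (unpickle n))); split.
  by move=> i; set t := odflt _ _; have [] := cP t.
move=> x r r0.
have [|p1] := @rat_in_itvoo R (x - r) x; first lra.
rewrite in_itv/= => /andP[p1r p1x].
have [p2] := rat_in_itvoo p1x; rewrite in_itv/= => /andP[p12 p2x].
have [|q2] := @rat_in_itvoo R x (x + r); first lra.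
rewrite in_itv/= => /andP[xq2 q2r].
have [q1] := rat_in_itvoo xq2; rewrite in_itv/= => /andP[xq1 q12].
exists (pickle ((p1, p2), (q1, q2))); rewrite pickleK /=.
have [_ _ /=] := cP ((p1, p2), (q1, q2)); rewrite -(ltr_rat R) -(ltr_rat R q1).
by move=> /(_ p12)/andP[? ?] /(_ q12)/andP[? ?]; split; lra.
Qed.

Variable c : nat -> R * R.
Hypothesis cS : forall i, ~ S (c i).1 /\ ~ S (c i).2.
Hypothesis c_basis : forall x r, 0 < r ->
  exists i, [/\ x - r < (c i).1, (c i).1 < x, x < (c i).2 & (c i).2 < x + r].

Let free n i := forall t, (c i).1 <= t <= (c i).2 -> ~ H n t.

Let P n i : set R := if `[< free n i >] then
  (H n.+1 `&` `[(c i).1, (c i).2]) `\` \bigcup_(j in [set j | (j < i)%N /\ free n j]) `](c j).1, (c j).2[%classic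
  else set0.

Let strict i x : S x -> (c i).1 <= x <= (c i).2 -> (c i).1 < x < (c i).2.
Proof.
move=> Sx; have [S1 S2] := cS i; rewrite !le_eqVlt => /andP[/orP[/eqP xE|->] /orP[/eqP xE'|->]] //.
- by case: S1; rewrite xE.
- by case: S1; rewrite xE.
- by case: S2; rewrite -xE'.
Qed.

Let P_in n i x : P n i x -> [/\ S x, ~ H n x, H n.+1 x & (c i).1 <= x <= (c i).2].
Proof.
rewrite /P; case: ifPn => // /asboolP ni [[Hx /=]]; rewrite in_itv/= => xc _.
have nHx := ni x xc; split => //; apply: HS Hx _ => H0.
by apply: nHx; apply: (@ndH 0%N).
Qed.

Let P_compact n i : compact (P n i).
Proof.
rewrite /P; case: ifPn => [_|_]; last exact: compact0.
apply: (@subclosed_compact _ _ `[(c i).1, (c i).2]); last 2 first.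
- exact: segment_compact.
- by move=> x [[]].
apply: closedI; first by apply: closedI => //; exact: interval_closed.
by apply: open_closedC; apply: bigcup_open => j _; exact: interval_open.
Qed.

Let P_open n i : exists2 O, open O & P n i = H n.+1 `&` O.
Proof.
have [ni|ni] := pselect (free n i); last first.
  by exists set0; [exact: open0|rewrite /P asboolF// setI0].
exists (`](c i).1, (c i).2[ `\` \bigcup_(j in [set j | (j < i)%N /\ free n j]) `[(c j).1, (c j).2]%classic).
  apply: openI; first exact: interval_open.
  apply: closed_openC; apply: closed_bigcup => [|j _]; last exact: interval_closed.
  by apply: (@sub_finite_set _ _ `I_i); [move=> j []|exact: finite_II].
apply/seteqP; split => x.
- move=> Px; have [Sx nHx Hx xc] := P_in Px; split => //.
  move: Px; rewrite /P asboolT// => -[_ nx]; split.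
    by rewrite /= in_itv/=; exact: strict.
  move=> [j /= [ji nj]]; rewrite in_itv/= => xj; apply: nx; exists j => //=.
  by rewrite in_itv/=; exact: strict.
- move=> [Hx [/= + nx]]; rewrite in_itv/= => /andP[cx xc]; rewrite /P asboolT//; split.
    by split => //=; rewrite in_itv/= !ltW.
  move=> [j /= jP]; rewrite in_itv/= => /andP[? ?]; apply: nx; exists j => //=.
  by rewrite in_itv/= !ltW.
Qed.

Let P_disjoint n i n' i' x : P n i x -> P n' i' x -> (n, i) = (n', i').
Proof.
wlog : n i n' i' / (n <= n')%N.
  move=> W; have [/W|/ltnW/W W' Px Px'] := leqP n n'; first exact.
  by apply/esym; exact: W'.
rewrite leq_eqVlt => /orP[/eqP <-|nn'] Px Px'; last first.
  have [_ _ Hx _] := P_in Px; have [_ nHx _ _] := P_in Px'.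
  by case: nHx; apply: ndH Hx.
suff W k l : P n k x -> P n l x -> ~ (k < l)%N.
  by have [/(W _ _ Px Px')|/(W _ _ Px' Px)|->] := ltngtP i i'.
move=> Pk Pl kl; have [Sx _ _ xk] := P_in Pk.
move: Pk Pl; rewrite /P; case: ifPn => // /asboolP nk _; case: ifPn => // _ [_]; apply.
by exists k => //=; rewrite in_itv/=; exact: strict.
Qed.

Let P_cover n x : H n x -> ~ H 0%N x -> exists m i, P m i x.
Proof.
elim: n => [//|n IH] Hx H0; have [/IH|nHx] := pselect (H n x); first exact.
exists n; have [r r0 rH] := open_ball_itv (closed_openC (@cH n)) nHx.
have [i [xi ix xi' ix']] := c_basis x r0.
have ex : exists i, `[< free n i /\ (c i).1 < x < (c i).2 >].
  exists i; apply/asboolP; split; last by rewrite ix.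
  by move=> t /andP[? ?]; apply: rH; rewrite /= in_itv/=; apply/andP; split; lra.
have [k /asboolP[nk /andP[kx xk]] kmin] := ex_minnP ex; exists k.
rewrite /P asboolT//; split; first by split => //=; rewrite in_itv/= !ltW.
move=> [j /= [jk nj]]; rewrite in_itv/= => xj.
suff : (k <= j)%N by rewrite leqNgt jk.
by apply: kmin; apply/asboolP.
Qed.

Let C k : set R := if pickle_inv k is Some (n, i) then P n i else set0.

Lemma disjoint_pieces_cut : exists C : nat -> set R, [/\ forall k, compact (C k),
  forall k l, k != l -> C k `&` C l = set0,
  forall k, exists n, exists2 O, open O & C k = H n `&` O,
  forall k x, C k x -> S x /\ ~ H 0%N x &
  forall n x, H n x -> ~ H 0%N x -> exists k, C k x].
Proof.
exists C; split.
- by move=> k; rewrite /C; case: (pickle_inv k) => [[n i]|]; [exact: P_compact|exact: compact0].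
- move=> k l /eqP kl; rewrite -subset0 => x [Ck Cl]; apply: kl.
  move: Ck Cl; rewrite /C.
  have := @pickle_invK (nat * nat)%type k; have := @pickle_invK (nat * nat)%type l.
  case: (pickle_inv k) => // -[n i]; case: (pickle_inv l) => // -[n' i'] /= <- <- Px Px'.
  by rewrite (P_disjoint Px Px').
- move=> k; rewrite /C; case: (pickle_inv k) => [[n i]|]; last first.
    by exists 0%N, set0; [exact: open0|rewrite setI0].
  by exists n.+1; exact: P_open.
- move=> k x; rewrite /C; case: (pickle_inv k) => [[n i]|//] Px.
  have [Sx nHx _ _] := P_in Px; split => // H0.
  by apply: nHx; apply: (@ndH 0%N).
- move=> n x Hx H0; have [m [i Px]] := P_cover Hx H0.
  by exists (pickle (m, i)); rewrite /C pickleK_inv.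
Qed.

End disjoint_pieces.

Lemma disjoint_pieces {R : realType} (S : set R) (H : nat -> set R) :
  (forall a b, a < b -> exists2 c, a < c < b & ~ S c) ->
  (forall n, closed (H n)) -> (forall m n, (m <= n)%N -> H m `<=` H n) ->
  (forall n x, H n x -> ~ H 0%N x -> S x) ->
  exists C : nat -> set R, [/\ forall k, compact (C k),
    forall k l, k != l -> C k `&` C l = set0,
    forall k, exists n, exists2 O, open O & C k = H n `&` O,
    forall k x, C k x -> S x /\ ~ H 0%N x &
    forall n x, H n x -> ~ H 0%N x -> exists k, C k x].
Proof.
move=> cut cH ndH HS; have [c [cS c_basis]] := cut_intervals cut.
exact: (@disjoint_pieces_cut _ S H cH ndH HS c cS c_basis).
Qed.

(** * The interior, and the theorem *)

Lemma steep_empty_interior {R : realType} (F : nat -> set R) : (forall n, closed (F n)) ->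
  (forall a b, a < b -> exists2 c, a < c < b & ~ (\bigcup_n F n) c) ->
  exists2 f, nearly_Lipschitz f & forall x, steep f x <-> (\bigcup_n F n) x.
Proof.
move=> cF cut; set S := \bigcup_n F n; pose V := null_part S.
have oV : open V by exact: open_null_part.
have mS : measurable S.
  by apply: bigcupT_measurable => n; exact: measurable_realfun.closed_measurable.
have /choice[A AP] : forall n, exists A, [/\ closed A, fat A, F n `\` V `<=` A & A `<=` S `\` V].
  move=> n; apply: fat_envelope => //; first by apply: closedI => //; exact: open_closedC.
  by move=> x [Fx Vx]; split => //; exists n.
have cA n : closed (A n) by case: (AP n).
have fA n : fat (A n) by case: (AP n).
(* The fat pieces exhaust [S \ V], and the null ones [S ∩ V]. *)
pose HA n := \bigcup_(i in `I_n) A i.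
have cHA n : closed (HA n) by apply: closed_bigcup => //; exact: finite_II.
have HA_S n x : HA n x -> S x /\ ~ V x by move=> [i _ Ax]; have [_ _ _ H] := AP i; exact: H.
have [||CA [cCA dCA CAo CAS CAc]] := @disjoint_pieces R S HA cut cHA.
- by move=> m n mn x [i /= im Ax]; exists i => //=; exact: leq_trans mn.
- by move=> n x /HA_S[].
pose HN n := (~` V) `|` \bigcup_(i in `I_n) F i.
have cHN n : closed (HN n).
  apply: closedU; first exact: open_closedC.
  by apply: closed_bigcup => //; exact: finite_II.
have HN0 x : ~ HN 0%N x -> V x by move=> Hx; apply: contrapT => Vx; apply: Hx; left.
have [||CN [cCN dCN CNo CNS CNc]] := @disjoint_pieces R S HN cut cHN.
- move=> m n mn x [Vx|[i /= im Fx]]; [by left|right].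
  by exists i => //=; exact: leq_trans mn.
- by move=> n x [Vx /HN0//|[i _ Fx] _]; exists i.
have CAV k x : CA k x -> ~ V x.
  by case: (CAo k) => n [B _ ->] [Hx _]; have [] := HA_S n x Hx.
have CNV k x : CN k x -> V x by move=> /CNS[_ /HN0].
pose C k := if odd k then CN k./2 else CA k./2.
have [||||f nf fP] := @steep_disjoint_pieces R C V (fun k => ~~ odd k) _ _ oV.
- by move=> k; rewrite /C; case: ifP.
- move=> k l kl; rewrite -subset0 => x; rewrite /C.
  case: ifPn => ok; case: ifPn => ol [].
  + move=> Ck Cl; have : (CN k./2 `&` CN l./2) x by [].
    rewrite dCN//; apply: contra kl => /eqP kl.
    by rewrite -(odd_double_half k) -(odd_double_half l) kl ok ol.
  + by move=> /CNV Vx /CAV.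
  + by move=> /CAV Vx /CNV.
  + move=> Ck Cl; have : (CA k./2 `&` CA l./2) x by [].
    rewrite dCA//; apply: contra kl => /eqP kl.
    by rewrite -(odd_double_half k) -(odd_double_half l) kl (negbTE ok) (negbTE ol).
- move=> k ok; rewrite /C (negbTE ok); split; last first.
    by rewrite -subset0 => x [/CAV].
  case: (CAo k./2) => n [B oB ->]; apply: fat_openI => //.
    exact: measurable_realfun.closed_measurable.
  by apply: fat_bigcup => //; exact: finite_II.
- move=> k; rewrite negbK => ok; rewrite /C ok; split; last by move=> x /CNV.
  apply: subset_measure0 (null_null_part mS).
  + by apply: measurable_realfun.closed_measurable; exact: compact_closedR.
  + by apply: measurableI => //; exact: measurable_realfun.open_measurable.
  + by move=> x Cx; split; [have [] := CNS _ _ Cx|exact: CNV Cx].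
exists f => // x; rewrite fP; split.
  by move=> [k]; rewrite /C; case: ifP => _; [move=> /CNS[]|move=> /CAS[]].
move=> [n _ Fx]; have [Vx|Vx] := pselect (V x).
  have [||k Cx] := CNc n.+1 x.
  - by right; exists n => /=.
  - by case=> [|[i]].
  by exists k.*2.+1; rewrite /C /= odd_double /= uphalf_double.
have [_ _ FA _] := AP n.
have [||k Cx] := CAc n.+1 x.
- by exists n => //=; apply: FA.
- by move=> [i].
by exists k.*2; rewrite /C odd_double half_double.
Qed.

(** Adding [p w], where [p] is the distance to the complement of [U], changes the
  function by a bounded slope off [U]; on [U] the term [p w] oscillates more than
  [g] does, provided [w] is rough with respect to the modulus of continuity of [g]. *)
Lemma steep_add_open {R : realType} (g : R -> R) (U : set R) : nearly_Lipschitz g -> open U ->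
  exists2 f : R -> R, continuous f & forall x, steep f x <-> U x \/ steep g x.
Proof.
move=> ng oU; have pow0 k : 0 < 1 / 64 ^+ k :> R by rewrite divr_gt0// exprn_gt0.
have /choice[e eP] : forall k, exists e, [/\ 0 < e, e <= 1 / 64 ^+ k &
    forall x y, `|x - y| <= e -> `|g x - g y| <= 1 / 64 ^+ k].
  move=> k; have [d d0 dP] := nearly_Lipschitz_modulus ng (pow0 k).
  exists (Num.min d (1 / 64 ^+ k)); split.
  - by rewrite lt_min d0 pow0.
  - by rewrite ge_min lexx orbT.
  - by move=> x y xy; apply: dP; apply: le_trans xy _; rewrite ge_min lexx.
have e0 k : 0 < e k by case: (eP k).
have [w [nw w1 wr _]] := rough_function e0.
pose p := dst (~` U).
have cg := nearly_Lipschitz_continuous ng; have cw := nearly_Lipschitz_continuous nw.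
exists (fun x => g x + p x * w x).
  by move=> x; apply: cvgD; [exact: cg|apply: cvgM; [exact: dst_continuous|exact: cw]].
move=> x; have [Ux|Ux] := pselect (U x); last first.
  have -> : (U x \/ steep g x) = steep g x by apply/propext; split => [[]|]; [|by []|right].
  apply: (@steepDr _ g (fun y => p y * w y)); exists 1, 1 => // y _.
  rewrite /p [dst _ x]dst_eq0// mul0r subr0 mul1r normrM ger0_norm ?dst_ge0//.
  apply: (@le_trans _ _ (dst (~` U) y)); first by rewrite ler_piMr ?dst_ge0.
  by rewrite distrC; exact: dst_le.
split => [|_]; first by left.
have px0 : 0 < p x by apply: dst_gt0; [exact: open_closedC|apply].
have [|K KP] := @half_expr_lt _ (p x / 128); first by rewrite divr_gt0.
apply: (@steep_scales _ _ _ (p x / 64) K) => [|k Kk]; first by rewrite divr_gt0.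
have [_ ek gk] := eP k.
have [t /andP[xt te] tP] := wr k x.
have xte : `|x - t| <= e k by rewrite ler0_norm; lra.
exists t; first exact: le_trans xte ek.
have k16 : 0 < (16 ^+ k)^-1 :> R by rewrite invr_gt0 exprn_gt0.
have small : 2 * (1 / 64 ^+ k) <= p x / 64 / 16 ^+ k.
  have -> : 64 ^+ k = 16 ^+ k * 4 ^+ k :> R by rewrite -exprMn -natrM.
  rewrite mul1r invfM mulrCA [leRHS]mulrC ler_pM2l//.
  have : 1 / 4 ^+ k <= 1 / 2 ^+ K :> R.
    rewrite !mul1r lef_pV2 ?posrE ?exprn_gt0//.
    apply: (@le_trans _ _ (2 ^+ k)); first by rewrite ler_weXn2l ?ler1n.
    by rewrite lerXn2r ?nnegrE// ler_nat.
  by move: KP; rewrite mul1r; lra.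
have main : p x / 32 / 16 ^+ k <= `|p x * (w t - w x)|.
  rewrite normrM gtr0_norm// -!mulrA ler_pM2l//.
have pt : `|(p t - p x) * w t| <= 1 / 64 ^+ k.
  rewrite normrM; apply: (@le_trans _ _ `|p t - p x|); first by rewrite ler_piMr.
  apply: le_trans (dst_lipschitz _ _ _) _; rewrite distrC; exact: le_trans xte ek.
have gt : `|g t - g x| <= 1 / 64 ^+ k by rewrite distrC; exact: gk.
have -> : g t + p t * w t - (g x + p x * w x) =
  p x * (w t - w x) - (- ((g t - g x) + (p t - p x) * w t)) by ring.
have := lerB_dist (p x * (w t - w x)) (- ((g t - g x) + (p t - p x) * w t)).
rewrite normrN; have := ler_normD (g t - g x) ((p t - p x) * w t).
move: small main; rewrite -![p x / _ / _]mulrA [_^-1 / _]mulrC [X in _ <= X -> _]mulrA.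
lra.
Qed.

Unset Implicit Arguments.
Set Strict Implicit.

Theorem theorem3p1 (R : realType) (F : set R) (hF : Fsigma F) :
  exists2 f : R -> R, continuous f & l_infty f = F.
Proof.
case: hF => E cE FE; pose U := F°; have oU : open U by exact: open_interior.
have SE : \bigcup_n (E n `\` U) = F `\` U by rewrite FE setDE setI_bigcupl.
have [|a b ab|g ng gP] := @steep_empty_interior R (fun n => E n `\` U).
- by move=> n; apply: closedI => //; exact: open_closedC.
- rewrite SE; apply: contrapT => nc.
  have IF : `]a, b[ `<=` F `\` U.
    move=> c /=; rewrite in_itv/= => acb; apply: contrapT => Sc; apply: nc; by exists c.
  have Im : [set` `]a, b[] ((a + b) / 2) by rewrite /= in_itv/=; apply/andP; split; lra.
  have [_ +] := IF _ Im; apply.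
  suff : [set` `]a, b[] `<=` F° by exact.
  rewrite -open_subsetE; last exact: interval_open.
  by move=> c /IF[].
have [f cf fP] := steep_add_open ng oU.
exists f => //; apply/seteqP; split => x.
  move=> /lip_steepE /fP [Ux|/gP]; first exact: interior_subset.
  by rewrite SE => -[].
move=> Fx; apply/lip_steepE/fP.
have [Ux|Ux] := pselect (U x); [by left|right].
by apply/gP; rewrite SE; split.
Qed.
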